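(* For each integer $d\ge 2$ let $Q_d := (-\pi,\pi)^d$, and let $C_{\mathbb{T}}^{as}(d)$ be the sharp (i.e. largest) constant such that $$C_{\mathbb{T}}^{as}(d)\int_{Q_d} \frac{|\psi(x)|^2}{\sum_{j=1}^d \sin^2(x_j/2)}\, dx \leq \int_{Q_d} |\nabla \psi(x)|^2\, dx$$ holds for all complex-valued antisymmetric functions $\psi \in C^\infty(\overline{Q_d})$ with zero average, $\int_{Q_d}\psi\,dx=0$, such that $\psi$ and all of its partial derivatives are $2\pi$-periodic in each variable. Then $C_{\mathbb{T}}^{as}(d) \sim d^4$ as $d \to \infty$; that is, there exist positive constants $c_1,c_2,N$, all independent of $d$, such that $c_1 d^4\le C_{\mathbb{T}}^{as}(d)\le c_2 d^4$ for all $d\ge N$.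
   Context: A map $g:\overline{Q_d}\to\mathbb{C}$ is $2\pi$-periodic in each variable if $g(x_1,\dots,x_{i-1},-\pi,x_{i+1},\dots,x_d)=g(x_1,\dots,x_{i-1},\pi,x_{i+1},\dots,x_d)$ for all $1\le i\le d$ (and all values of the other coordinates in $[-\pi,\pi]$). A function $\psi$ is antisymmetric if $\psi(\dots,x_j,\dots,x_i,\dots) = -\psi(\dots,x_i,\dots,x_j,\dots)$ for all $1\le i\neq j\le d$, i.e. interchanging any two coordinates of the argument changes the sign of $\psi$. $C^\infty(\overline{Q_d})$ denotes functions smooth up to the boundary. *)

(* Defs.v *)
From HB Require Import structures.
From mathcomp Require Import all_boot all_order all_algebra.
From mathcomp Require Import all_classical all_reals all_analysis.
From mathcomp Require Import complex.

Set Implicit Arguments.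
Unset Strict Implicit.
Unset Printing Implicit Defensive.

Import Order.TTheory GRing.Theory Num.Theory.
Import numFieldNormedType.Exports.

Local Open Scope classical_set_scope.
Local Open Scope ring_scope.

(* The library puts a sigma-algebra, but no measure, on [n.-tuple T].
   Lebesgue measure on R^n is built by induction on n, as the image of
   [lebesgue_measure \x mu] under the bijection R * R^n -> R^(n+1). *)
Section lebesgue_measure_cons.
Context (R : realType) (n : nat).
Let T := measurableTypeR R.
Variable mu : {sigma_finite_measure set (n.-tuple T) -> \bar R}.

Definition tuple_cons (p : T * n.-tuple T) : n.+1.-tuple T :=
  [tuple of p.1 :: p.2].

Lemma measurable_tuple_cons : measurable_fun [set: T * n.-tuple T] tuple_cons.
Proof. exact: measurable_cons. Qed.

Definition lebesgue_measure_cons : set (n.+1.-tuple T) -> \bar R :=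
  pushforward (@lebesgue_measure R \x mu)%E tuple_cons.

Let lebesgue_measure_cons0 : lebesgue_measure_cons set0 = 0%E.
Proof. by rewrite /lebesgue_measure_cons /pushforward preimage_set0 measure0. Qed.

Let lebesgue_measure_cons_ge0 A : (0 <= lebesgue_measure_cons A)%E.
Proof. by rewrite /lebesgue_measure_cons /pushforward measure_ge0. Qed.

Let lebesgue_measure_cons_sigma_additive :
  semi_sigma_additive lebesgue_measure_cons.
Proof.
move=> F mF tF mUF; rewrite /lebesgue_measure_cons /pushforward preimage_bigcup.
apply: measure_semi_sigma_additive.
- by move=> k; rewrite -[X in measurable X]setTI; exact: measurable_tuple_cons.
- apply/trivIsetP => /= i j _ _ ij; rewrite -preimage_setI.
  by move/trivIsetP : tF => /(_ _ _ _ _ ij) ->//; rewrite preimage_set0.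
- rewrite -preimage_bigcup -[X in measurable X]setTI.
  exact: measurable_tuple_cons.
Qed.

HB.instance Definition _ := isMeasure.Build _ _ _ lebesgue_measure_cons
  lebesgue_measure_cons0 lebesgue_measure_cons_ge0
  lebesgue_measure_cons_sigma_additive.

Let lebesgue_measure_cons_sigma_finite :
  sigma_finite [set: n.+1.-tuple T] lebesgue_measure_cons.
Proof.
have [F FT mF] : sigma_finite [set: T * n.-tuple T]
    (@lebesgue_measure R \x mu)%E.
  have /sigma_finiteP[F [TF ndF Foo]] := sigma_finiteT (@lebesgue_measure R).
  have /sigma_finiteP[G [TG ndG Goo]] := sigma_finiteT mu.
  exists (fun k => F k `*` G k).
    rewrite -setXTT TF TG; apply/seteqP; split=> -[x y].
      move=> [/= [k _ Fkx] [l _ Gly]]; exists (maxn k l) => //; split.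
      - by move: x Fkx; exact/subsetPset/ndF/leq_maxl.
      - by move: y Gly; exact/subsetPset/ndG/leq_maxr.
    by move=> [k _ []/= ? ?]; split; exists k.
  move=> k; have [? ?] := Foo k; have [? ?] := Goo k.
  split; first exact: measurableX.
  by rewrite product_measure1E// lte_mul_pinfty// ge0_fin_numE.
pose uncons (t : n.+1.-tuple T) : T * n.-tuple T :=
  (thead t, [tuple of behead t]).
have consK : cancel tuple_cons uncons.
  by move=> [x t]; congr pair; apply/val_inj.
have muncons : measurable_fun [set: n.+1.-tuple T] uncons.
  apply/measurable_fun_pairP; split; first exact: measurable_tnth.
  exact: measurable_behead.
exists (fun k => uncons @^-1` F k).
  rewrite -preimage_bigcup -FT; exact/esym/preimage_setT.
move=> k; have [mFk Fk] := mF k; split.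
  by rewrite -[X in measurable X]setTI; exact: muncons.
rewrite /lebesgue_measure_cons /pushforward.
rewrite (_ : tuple_cons @^-1` _ = F k)//.
by rewrite -comp_preimage; apply/seteqP; split=> p; rewrite /= consK.
Qed.

HB.instance Definition _ := Measure_isSigmaFinite.Build _ _ _
  lebesgue_measure_cons lebesgue_measure_cons_sigma_finite.

End lebesgue_measure_cons.

Section lebesgue_measure_nil_def.
Context (R : realType).
Let T := measurableTypeR R.

Definition lebesgue_measure_nil : set (0.-tuple T) -> \bar R :=
  dirac (nil_tuple T : 0.-tuple T).

HB.instance Definition _ := Measure.on lebesgue_measure_nil.

Let lebesgue_measure_nil_sigma_finite :
  sigma_finite [set: 0.-tuple T] lebesgue_measure_nil.
Proof.
exists (fun=> setT); first by rewrite bigcup_const.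
by move=> _; split => //; rewrite /lebesgue_measure_nil diracT ltry.
Qed.

HB.instance Definition _ := Measure_isSigmaFinite.Build _ _ _
  lebesgue_measure_nil lebesgue_measure_nil_sigma_finite.

End lebesgue_measure_nil_def.

Fixpoint lebesgue_measure_tuple (R : realType) (n : nat) :
    {sigma_finite_measure set (n.-tuple (measurableTypeR R)) -> \bar R} :=
  match n with
  | 0 => @lebesgue_measure_nil R
  | m.+1 => lebesgue_measure_cons (lebesgue_measure_tuple R m)
  end.

Section torus_hardy.
Context (R : realType) (d : nat).
Implicit Types (x : 'rV[R]_d) (i j : 'I_d) (f : 'rV[R]_d -> R)
  (psi : 'rV[R]_d -> R[i]).

Definition cube : set 'rV[R]_d := [set x | forall i, - pi < x 0 i < pi].

Definition closed_cube : set 'rV[R]_d :=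
  [set x | forall i, - pi <= x 0 i <= pi].

(* Topology and differentiation live on ['rV_d], measure on [d.-tuple]. *)
Definition row_of_tuple (t : d.-tuple (measurableTypeR R)) : 'rV[R]_d :=
  \row_i tnth t i.

Definition cube_integral f : \bar R :=
  (\int[lebesgue_measure_tuple R d]_(t in row_of_tuple @^-1` cube)
     (f (row_of_tuple t))%:E)%E.

Definition partial i f : 'rV[R]_d -> R := 'D_(delta_mx 0 i) f.

Definition partials (s : seq 'I_d) f : 'rV[R]_d -> R := foldr partial f s.

Definition boundary_ext f x : R := lim (f @ within cube (nbhs x)).

(* Functions are total on R^d, but only their values on the closed cube matter:
   derivatives are taken in the open cube, and each of them is required to
   extend continuously to the closed cube. *)
Definition smooth_closed_cube f : Prop :=
  {within closed_cube, continuous f} /\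
  forall s : seq 'I_d,
    (forall x i, cube x -> derivable (partials s f) x (delta_mx 0 i)) /\
    (forall x, closed_cube x -> cvg (partials s f @ within cube (nbhs x))).

Definition set_coord i (a : R) x : 'rV[R]_d :=
  \row_j (if j == i then a else x 0 j).

Definition periodic (g : 'rV[R]_d -> R) : Prop :=
  forall x i, closed_cube x -> g (set_coord i (- pi) x) = g (set_coord i pi x).

Definition periodic_with_partials f : Prop :=
  periodic f /\ forall s : seq 'I_d, periodic (boundary_ext (partials s f)).

Definition re_part psi : 'rV[R]_d -> R := fun x => complex.Re (psi x).
Definition im_part psi : 'rV[R]_d -> R := fun x => complex.Im (psi x).

Definition antisymmetric_fun psi : Prop :=
  forall x i j, closed_cube x -> i != j -> psi (xcol i j x) = - psi x.

Record admissible psi : Prop := Admissible {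
  admissible_smooth :
    smooth_closed_cube (re_part psi) /\ smooth_closed_cube (im_part psi);
  admissible_antisymmetric : antisymmetric_fun psi;
  admissible_periodic :
    periodic_with_partials (re_part psi) /\
    periodic_with_partials (im_part psi);
  admissible_average :
    cube_integral (re_part psi) = 0%E /\ cube_integral (im_part psi) = 0%E }.

Definition cpartial j psi x : R[i] :=
  (partial j (re_part psi) x +i* partial j (im_part psi) x)%C.

Definition sqr_norm_gradient psi x : R :=
  \sum_(j < d) ComplexField.Normc.normc (cpartial j psi x) ^+ 2.

(* On the cube the denominator vanishes only at the origin, a null set. *)
Definition hardy_density psi x : R :=
  ComplexField.Normc.normc (psi x) ^+ 2 / \sum_(j < d) sin (x 0 j / 2) ^+ 2.

Definition hardy_inequality (C : R) : Prop :=
  forall psi, admissible psi ->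
    (C%:E * cube_integral (hardy_density psi) <=
       cube_integral (sqr_norm_gradient psi))%E.

Definition sharp_hardy_constant (C : R) : Prop :=
  hardy_inequality C /\ forall C' : R, hardy_inequality C' -> C' <= C.

End torus_hardy.

(* Main.v *)
Require Import Defs.
From mathcomp Require Import all_boot all_order all_algebra.
From mathcomp Require Import all_classical all_reals all_analysis.
From mathcomp Require Import perm measurable_realfun complex ring lra.

Set Implicit Arguments.
Unset Strict Implicit.
Unset Printing Implicit Defensive.

Import Order.TTheory GRing.Theory Num.Theory.
Import numFieldNormedType.Exports.

Local Open Scope classical_set_scope.
Local Open Scope ring_scope.

(** The constants for which the inequality holds form a set with a largest
    element as soon as it is bounded above ([hardy_inequality_sup]), so the
    theorem reduces to exhibiting one admissible constant of order d^4 and one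
    test function that forbids constants of larger order.

    Lower bound.  Write s for the sum of the sin^2 (x_j / 2).  Where the
    coordinates are distinct, the function
      phi = s^(- alpha) * prod_(i < j) sin ((x_i - x_j) / 2)
    is a supersolution: for alpha = d^2 / 24 and d >= 3,
      - Laplacian phi / phi >= (d^4 / 96) / s       ([ground_div_le]).
    The product alone is an eigenfunction with eigenvalue about d^3 / 12, by the
    addition formula for the cotangent ([sum_sqr_of_triples]); being homogeneous
    of degree d (d - 1) / 2 to leading order at the origin, it also makes the
    factor s^(- alpha) gain about alpha d^2 / (2 s), while that factor costs
    alpha d, which the eigenvalue absorbs.  With F = grad (log phi), integrating
    the identity
      |grad f|^2 + (div F + |F|^2) f^2 = |grad f - f F|^2 + div (f^2 F)
    over the torus then gives the Hardy inequality for real f, because the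
    divergence of a periodic field integrates to 0.  As F is singular where
    two coordinates agree, a number e > 0 is first added to its denominators
    ([ground_integral_inequality]).  An antisymmetric periodic f vanishes on the
    diagonals, and satisfies f^2 <= K (1 - cos (x_i - x_j))
    ([antisymmetric_sqr_le]); this keeps (div F + |F|^2) f^2 bounded uniformly
    in e, and dominated convergence yields the limit e = 0 ([real_hardy]).
    Applying this to the real and the imaginary part gives d^4 / 96.

    Upper bound.  The determinant of the cos (j x_i), for j < d, is
    antisymmetric and is an eigenfunction of the Laplacian with eigenvalue
    - sum_(j < d) j^2, at least - d^3.  Since s <= d, the inequality for this
    function forces the constant to be at most d^4.  The determinant is not
    identically 0, for Chebyshev polynomials turn it into a Vandermonde
    determinant.

    The only integration by parts used is that the j-th partial derivative of a
    periodic function integrates to 0 ([rint_periodic_partial]): Fubini's theorem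
    brings the j-th coordinate inside, where the fundamental theorem of
    calculus applies. *)

(** * Integration over tuples, one coordinate at a time *)

Section tuple_measure.
Context (R : realType).
Local Notation T := (measurableTypeR R).
Local Notation leb := (@lebesgue_measure R).
Local Notation mu n := (lebesgue_measure_tuple R n).

Definition box n (A : 'I_n -> set T) : set (n.-tuple T) :=
  [set t | forall i, A i (tnth t i)].

Lemma measurable_box n (A : 'I_n -> set T) :
  (forall i, measurable (A i)) -> measurable (box A).
Proof.
move=> mA.
have -> : box A = \bigcap_(i in [set: 'I_n]) ((fun t => tnth t i) @^-1` (A i)).
  by apply/seteqP; split=> t At i; [move=> _|]; exact: At.
apply: fin_bigcap_measurable => [|i _]; first exact: finite_finset.
rewrite -[X in measurable X]setTI; exact: measurable_tnth.
Qed.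

Lemma preimage_cons_box n (A : 'I_n.+1 -> set T) :
  @tuple_cons R n @^-1` box A = A ord0 `*` box (fun i => A (lift ord0 i)).
Proof.
apply/seteqP; split=> -[a t] /=.
  by move=> At; split=> [|i]; [have := At ord0; rewrite tnth0|
    have := At (lift ord0 i); rewrite tnthS].
move=> [Aa At] i; case: (unliftP ord0 i) => [j|] ->; last by rewrite tnth0.
by rewrite tnthS; exact: At.
Qed.

Lemma measure_box n (A : 'I_n -> set T) : (forall i, measurable (A i)) ->
  (mu n (box A) = \prod_(i < n) leb (A i))%E.
Proof.
elim: n A => [|n IH] A mA.
  rewrite big_ord0 /= /lebesgue_measure_nil diracE mem_set//.
  by case.
rewrite big_ord_recl -IH// -product_measure1E//; last exact: measurable_box.
by rewrite -preimage_cons_box.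
Qed.

Definition tcube n : set (n.-tuple T) := box (fun=> `]- pi, pi[%classic).

Lemma measurable_tcube n : measurable (@tcube n).
Proof. by apply: measurable_box => i; exact: measurable_itv. Qed.

Lemma tcube_fin n : (mu n (@tcube n) < +oo)%E.
Proof.
rewrite measure_box; last by move=> i; exact: measurable_itv.
rewrite (eq_bigr (fun=> (pi - - pi)%:E)) => [|i _].
  by rewrite prodEFin ltry.
by rewrite lebesgue_measure_itv/= lte_fin gtrN ?pi_gt0.
Qed.

Definition upd n (j : 'I_n) (a : T) (t : n.-tuple T) : n.-tuple T :=
  [tuple if i == j then a else tnth t i | i < n].

(** Functions on the cube are extended by 0, so that Fubini's theorem is only ever
    used on the whole space; boundedness makes every slice integrable, and not
    just almost every one. *)
Record bounded_on_cube n (g : n.-tuple T -> R) : Prop := BoundedOnCube {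
  boc_meas : measurable_fun setT g;
  boc_bound : exists M : R, forall t, `|g t| <= M;
  boc_supp : forall t, ~ tcube t -> g t = 0 }.

Lemma boc_integrable n (g : n.-tuple T -> R) : bounded_on_cube g ->
  (mu n).-integrable setT (EFin \o g).
Proof.
case=> mg [M gM] g0.
have -> : EFin \o g = (EFin \o g) \_ (@tcube n).
  apply/funext => t; rewrite patchE; case: ifPn => // /negP; rewrite inE => ?.
  by rewrite /= g0.
apply/(integrable_mkcond _ (@measurable_tcube n)).
apply: (measurable_bounded_integrable (@measurable_tcube n)).
- exact: tcube_fin.
- exact: measurable_funTS.
- exists M; split; first by rewrite num_real.
  by move=> x Mx t _; exact: le_trans (gM t) (ltW Mx).
Qed.

Lemma tcube_cons n (a : T) (t : n.-tuple T) :
  tcube (tuple_cons (a, t)) <-> (a \in `]- pi, pi[) /\ tcube t.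
Proof.
split=> [At|[Aa At] i].
  split=> [|i]; first by have := At ord0; rewrite tnth0.
  by have := At (lift ord0 i); rewrite tnthS.
by case: (unliftP ord0 i) => [j|] ->; rewrite ?tnth0// tnthS; exact: At.
Qed.

Lemma boc_integrable_prod n (g : n.+1.-tuple T -> R) : bounded_on_cube g ->
  (leb \x mu n)%E.-integrable setT (fun p => (g (tuple_cons p))%:E).
Proof.
move=> bg; have := boc_integrable bg; case: bg => mg [M gM] g0.
move=> /integrableP[_ ig]; apply/integrableP; split.
  by apply/measurable_EFinP; apply: measurableT_comp => //; exact: measurable_tuple_cons.
move: ig; rewrite -[X in (X < _)%E -> _]
  /(\int[pushforward (leb \x mu n)%E (@tuple_cons R n)]_t (abse \o (EFin \o g)) t)%E.
rewrite ge0_integral_pushforward//; first exact: measurable_tuple_cons.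
- by apply: measurableT_comp => //; exact/measurable_EFinP.
- by move=> ? _; exact: abse_ge0.
Qed.

Lemma integral_tuple_cons n (g : n.+1.-tuple T -> R) : bounded_on_cube g ->
  (\int[mu n.+1]_t (g t)%:E =
   \int[(leb \x mu n)%E]_p (g (tuple_cons p))%:E)%E.
Proof.
move=> bg.
rewrite -[LHS]/(\int[pushforward (leb \x mu n)%E (@tuple_cons R n)]_t (EFin \o g) t)%E.
rewrite (@integral_pushforward _ _ _ _ _ _ (@measurable_tuple_cons R n)
  (leb \x mu n)%E setT (EFin \o g))//.
- by apply/measurable_EFinP; case: bg.
- rewrite preimage_setT; exact: boc_integrable_prod.
Qed.

Lemma boc_cons n (g : n.+1.-tuple T -> R) (a : T) : bounded_on_cube g ->
  bounded_on_cube (fun t => g (tuple_cons (a, t))).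
Proof.
case=> mg [M gM] g0; split.
- apply: (measurable_fun_pair2 (f := fun p => g (tuple_cons p)) a).
  by apply: measurableT_comp => //; exact: measurable_tuple_cons.
- by exists M.
- by move=> t nt; apply: g0 => /tcube_cons[].
Qed.

Lemma upd_cons0 n (a b : T) (t : n.-tuple T) :
  upd ord0 a (tuple_cons (b, t)) = tuple_cons (a, t).
Proof.
apply: eq_from_tnth => i; rewrite tnth_mktuple.
by case: (unliftP ord0 i) => [j|] ->; rewrite ?tnth0//= !tnthS.
Qed.

Lemma upd_consS n (a b : T) (t : n.-tuple T) j :
  upd (lift ord0 j) a (tuple_cons (b, t)) = tuple_cons (b, upd j a t).
Proof.
apply: eq_from_tnth => i; rewrite tnth_mktuple.
case: (unliftP ord0 i) => [k|] ->; rewrite ?tnth0//= !tnthS.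
by rewrite tnth_mktuple (inj_eq lift_inj).
Qed.

(** Lebesgue measure on tuples is built by consing, so this goes by induction on the
    dimension: Fubini's theorem either integrates the head first, when it is
    coordinate [j], or last, leaving the induction hypothesis for the tail. *)
Lemma integral_slice0 n (g : n.-tuple T -> R) (j : 'I_n) : bounded_on_cube g ->
  (forall t, \int[leb]_a (g (upd j a t))%:E = 0)%E ->
  (\int[mu n]_t (g t)%:E = 0)%E.
Proof.
elim: n g j => [|n IH] g j; first by case: j.
move=> bg g0; rewrite integral_tuple_cons//.
have ig := boc_integrable_prod bg.
case: (unliftP ord0 j) => [k|] jE.
- rewrite -integral12_prod_meas1//.
  apply: integral0_eq => a _.
  apply: (IH (fun t => g (tuple_cons (a, t))) k); first exact: boc_cons.
  move=> t; rewrite -[RHS](g0 (tuple_cons (a, t))).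
  by apply: eq_integral => b _; rewrite jE upd_consS.
- rewrite -integral21_prod_meas1//.
  apply: integral0_eq => t _.
  rewrite -[RHS](g0 (tuple_cons (0, t))).
  by apply: eq_integral => b _; rewrite jE upd_cons0.
Qed.

Lemma preimage_cube n : @row_of_tuple R n @^-1` cube (R:=R) (d:=n) = @tcube n.
Proof.
by apply/seteqP; split => t /= ct i; have := ct i; rewrite mxE /= in_itv.
Qed.

(** The sigma-algebra of tuples is generated by boxes, and an open set is the union of
    the countably many cubes with rational centre and radius 1/(k+1) that it
    contains. *)
Lemma measurable_open_row n (U : set 'rV[R]_n) :
  open U -> measurable (@row_of_tuple R n @^-1` U).
Proof.
move=> oU.
pose B (qk : {ffun 'I_n -> rat} * nat) : set (n.-tuple T) :=
  box (fun i => [set y | `|ratr (qk.1 i) - y| < qk.2.+1%:R^-1 :> R]).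
pose good qk := B qk `<=` @row_of_tuple R n @^-1` U.
have -> : @row_of_tuple R n @^-1` U =
    \bigcup_qk (if `[< good qk >] then B qk else set0).
  apply/seteqP; split=> [t /= Ut|t [qk _]]; last by case: asboolP => [g /g|].
  have /nbhs_ballP[e /= e0 eU] : nbhs (row_of_tuple t) U by exact: open_nbhs_nbhs.
  have [k ke] : exists k : nat, k.+1%:R^-1 < e / 2.
    have := near_infty_natSinv_lt (PosNum (divr_gt0 e0 (ltr0n R 2))).
    by case=> k _ /(_ k (leqnn k)); exists k.
  have k0 : 0 < k.+1%:R^-1 :> R by rewrite invr_gt0.
  have /choice[q qt] : forall i, exists q, `|ratr q - tnth t i| < k.+1%:R^-1 :> R.
    move=> i.
    have /rat_in_itvoo[q] : tnth t i - k.+1%:R^-1 < tnth t i + k.+1%:R^-1.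
      by rewrite ltrBlDr -addrA ltrDl addr_gt0.
    rewrite in_itv/= => /andP[q1 q2]; exists q.
    by rewrite /ball/= ltr_distl q1 q2.
  have Bt : B ([ffun i => q i], k) t by move=> i /=; rewrite ffunE; exact: qt.
  exists ([ffun i => q i], k) => //; rewrite asboolT// => u Bu /=; apply: eU.
  split => // i j; rewrite (ord1 i) !mxE.
  have := Bt j; have := Bu j; rewrite /B/= ffunE.
  have half_close (x y z r : R) :
      r < e / 2 -> `|z - y| < r -> `|z - x| < r -> `|x - y| < e.
    by rewrite !ltr_norml => ? /andP[? ?] /andP[? ?]; apply/andP; split; lra.
  by rewrite /ball/=; exact: half_close ke.
apply: countable_bigcupT_measurable => // qk; case: asboolP => // _.
apply: measurable_box => i; exact: (@measurable_ball R (ratr (qk.1 i)) qk.2.+1%:R^-1).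
Qed.

Definition cont_cube n (g : 'rV[R]_n -> R) := forall x, cube x -> {for x, continuous g}.

Lemma open_cube n : open (@cube R n).
Proof.
rewrite openE => x cx.
apply: (@filter_forall _ _ (fun i (y : 'rV[R]_n) => - pi < y 0 i < pi) (nbhs x)) => i.
have /near_in_itvoo : x 0 i \in `]- pi, pi[ by rewrite in_itv/=.
move/(@coord_continuous R 1 n 0 i x) => h; near=> y.
have : y 0 i \in `]- pi, pi[ by near: y; exact: h.
by rewrite in_itv.
Unshelve. all: by end_near. 
Qed.

Lemma cont_cube_measurable n (g : 'rV[R]_n -> R) : cont_cube g ->
  measurable_fun (@tcube n) (g \o @row_of_tuple R n).
Proof.
move=> cg; apply: (measurability _ (RGenOpens.measurableE R)).
move=> _ [_ [a [b ->] <-]].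
rewrite -preimage_cube.
apply: (@measurable_open_row n (cube (R:=R) (d:=n) `&` g @^-1` `]a, b[%classic)).
rewrite openE => x [cx gx]; apply: filterI.
  by apply: open_nbhs_nbhs; split; [exact: open_cube|].
by apply: (cg x cx); apply: open_nbhs_nbhs; split; [exact: interval_open|].
Qed.
End tuple_measure.

(** * Integration over the cube *)

Section cube_integration.
Context (R : realType) (n : nat).
Local Notation T := (measurableTypeR R).
Local Notation leb := (@lebesgue_measure R).
Local Notation mu := (lebesgue_measure_tuple R n).
Local Notation row := (@row_of_tuple R n).
Implicit Types (g h : 'rV[R]_n -> R) (x : 'rV[R]_n) (j : 'I_n).

Record tame g : Prop := Tame {
  tame_meas : measurable_fun (@tcube R n) (g \o row);
  tame_bound : exists M : R, forall x, cube x -> `|g x| <= M }.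

Definition rint g : R := fine (cube_integral g).

Lemma tcubeP (t : n.-tuple T) : tcube t <-> cube (row t).
Proof. by rewrite -[X in _ <-> X]/((row @^-1` cube (R:=R) (d:=n)) t) preimage_cube. Qed.

Lemma tame_integrable g : tame g -> mu.-integrable (@tcube R n) (EFin \o (g \o row)).
Proof.
case=> mg [M gM].
apply: (measurable_bounded_integrable (@measurable_tcube R n)) => //.
  exact: tcube_fin.
exists M; split; first by rewrite num_real.
by move=> x Mx t /= ct; apply: le_trans (ltW Mx); apply: gM; exact/tcubeP.
Qed.

Lemma cube_integralE g : cube_integral g = (\int[mu]_(t in @tcube R n) (g (row t))%:E)%E.
Proof. by rewrite /cube_integral preimage_cube. Qed.

Lemma cube_integral_rint g : tame g -> cube_integral g = (rint g)%:E.
Proof.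
move=> /tame_integrable ig; rewrite /rint fineK// cube_integralE.
apply: integrable_fin_num => //; exact: measurable_tcube.
Qed.

Lemma eq_cube_integral g h : (forall x, cube x -> g x = h x) ->
  cube_integral g = cube_integral h.
Proof.
move=> gh; rewrite !cube_integralE; apply: eq_integral => t.
by rewrite inE => /tcubeP ct; rewrite gh.
Qed.

Lemma eq_rint g h : (forall x, cube x -> g x = h x) -> rint g = rint h.
Proof. by move=> gh; rewrite /rint (eq_cube_integral gh). Qed.

Lemma tame_eq g h : (forall x, cube x -> g x = h x) -> tame g -> tame h.
Proof.
move=> gh [mg [M gM]]; split.
  apply: eq_measurable_fun mg => t; rewrite inE => /tcubeP ct /=; exact: gh.
by exists M => x cx; rewrite -gh//; exact: gM.
Qed.

Lemma tameD g h : tame g -> tame h -> tame (fun x => g x + h x).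
Proof.
move=> [mg [M gM]] [mh [N hN]]; split; first exact: measurable_funD mg mh.
exists (M + N) => x cx; apply: le_trans (ler_normD _ _) _.
by rewrite lerD// ?gM ?hN.
Qed.

Lemma tameM g h : tame g -> tame h -> tame (fun x => g x * h x).
Proof.
move=> [mg [M gM]] [mh [N hN]]; split; first exact: measurable_funM mg mh.
by exists (M * N) => x cx; rewrite normrM ler_pM// ?gM ?hN.
Qed.

Lemma tame_cst c : tame (fun=> c).
Proof. by split; [exact: measurable_cst|exists `|c|]. Qed.

Lemma tameZ c g : tame g -> tame (fun x => c * g x).
Proof. by apply: tameM; exact: tame_cst. Qed.

Lemma tameN g : tame g -> tame (fun x => - g x).
Proof. by move=> /(tameZ (-1)); apply: tame_eq => x _; rewrite mulN1r. Qed.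

Lemma tameB g h : tame g -> tame h -> tame (fun x => g x - h x).
Proof. by move=> tg /tameN; exact: tameD. Qed.

Lemma tameX g k : tame g -> tame (fun x => g x ^+ k).
Proof.
move=> tg; elim: k => [|k IH]; first exact: tame_cst.
by apply: tame_eq (tameM tg IH) => x _; rewrite exprS.
Qed.

Lemma tame_sum (I : Type) (r : seq I) (P : pred I) (F : I -> 'rV[R]_n -> R) :
  (forall i, P i -> tame (F i)) -> tame (fun x => \sum_(i <- r | P i) F i x).
Proof.
move=> tF; elim: r => [|i r IH].
  by apply: tame_eq (tame_cst 0) => x _; rewrite big_nil.
case Pi : (P i); last by apply: tame_eq IH => x _; rewrite big_cons Pi.
by apply: tame_eq (tameD (tF _ Pi) IH) => x _; rewrite big_cons Pi.
Qed.

Lemma rintE g : rint g = (\int[mu]_(t in @tcube R n) (g (row t)))%R.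
Proof. by rewrite /rint cube_integralE. Qed.

Lemma rint_eq0 g : cube_integral g = 0%E -> rint g = 0.
Proof. by rewrite /rint => ->. Qed.

Lemma rintD g h : tame g -> tame h -> rint (fun x => g x + h x) = rint g + rint h.
Proof.
move=> /tame_integrable ig /tame_integrable ih; rewrite !rintE.
by apply: RintegralD => //; exact: measurable_tcube.
Qed.

Lemma rintZ c g : tame g -> rint (fun x => c * g x) = c * rint g.
Proof.
move=> /tame_integrable ig; rewrite !rintE.
by apply: RintegralZl => //; exact: measurable_tcube.
Qed.

Lemma rintN g : tame g -> rint (fun x => - g x) = - rint g.
Proof. by move=> tg; rewrite -mulN1r -rintZ//; apply: eq_rint => x _; rewrite mulN1r. Qed.

Lemma rintB g h : tame g -> tame h -> rint (fun x => g x - h x) = rint g - rint h.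
Proof. by move=> tg th; rewrite rintD ?rintN//; exact: tameN. Qed.

Lemma rint0 : rint (fun=> 0) = 0.
Proof. by have := rintZ 0 (tame_cst 0); rewrite !mul0r. Qed.

Lemma rint_sum (I : Type) (r : seq I) (P : pred I) (F : I -> 'rV[R]_n -> R) :
  (forall i, P i -> tame (F i)) ->
  rint (fun x => \sum_(i <- r | P i) F i x) = \sum_(i <- r | P i) rint (F i).
Proof.
move=> tF; elim: r => [|i r IH].
  by rewrite big_nil -[RHS]rint0; apply: eq_rint => x _; rewrite big_nil.
rewrite big_cons -IH; case: ifPn => Pi; last first.
  by apply: eq_rint => x _; rewrite big_cons (negbTE Pi).
rewrite -rintD; [|exact: tF|exact: tame_sum].
by apply: eq_rint => x _; rewrite big_cons Pi.
Qed.

Lemma rint_ge0 g : (forall x, cube x -> 0 <= g x) -> 0 <= rint g.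
Proof. by move=> g0; rewrite rintE; apply: Rintegral_ge0 => t /tcubeP; exact: g0. Qed.

Lemma le_rint g h : tame g -> tame h -> (forall x, cube x -> g x <= h x) ->
  rint g <= rint h.
Proof.
move=> tg th gh; rewrite -subr_ge0 -rintB//; apply: rint_ge0 => x cx.
by rewrite subr_ge0 gh.
Qed.

(** Near a point where it is positive, [g] exceeds half its value on a small box, and
    boxes have positive measure. *)
Lemma rint_gt0 g : tame g -> (forall x, cube x -> 0 <= g x) ->
  (exists2 x, cube x /\ {for x, continuous g} & 0 < g x) -> 0 < rint g.
Proof.
move=> tg g0 [x [cx gx]] gx0.
have /nbhs_ballP[e /= e0 eP] : \forall y \near x, cube y /\ g x / 2 < g y.
  apply: filterI; first by apply: open_nbhs_nbhs; split=> //; exact: open_cube.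
  by apply: (cvgr_gt (g x) gx); rewrite ltr_pdivrMr// ltr_pMr// ltr1n.
pose B : set (n.-tuple T) := box (fun i => (ball (x 0 i) e : set R)).
have mB : measurable B by apply: measurable_box => i; exact: measurable_ball.
have BP t : B t -> cube (row t) /\ g x / 2 < g (row t).
  by move=> Bt; apply: eP; split => // i j; rewrite (ord1 i) mxE; exact: Bt.
have muB : (mu B = ((e *+ 2) ^+ n)%:E)%E.
  rewrite measure_box; last by move=> i; exact: measurable_ball.
  rewrite (eq_bigr (fun=> (e *+ 2)%:E)) => [|i _].
    by rewrite prodEFin prodr_const card_ord.
  by rewrite lebesgue_measure_ball// ltW.
rewrite -lte_fin -cube_integral_rint// cube_integralE.
have mg : measurable_fun (@tcube R n) (fun t => (g (row t))%:E).
  by apply/measurable_EFinP; case: tg.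
have BC : B `<=` @tcube R n by move=> t /BP[/tcubeP].
apply: (@lt_le_trans _ _ (\int[mu]_(t in B) (g (row t))%:E)%E); last first.
  apply: ge0_subset_integral => //; first exact: measurable_tcube.
  by move=> t /tcubeP ct; rewrite lee_fin g0.
apply: (@lt_le_trans _ _ (\int[mu]_(t in B) (g x / 2)%:E)%E).
  have -> : (\int[mu]_(t in B) (g x / 2)%:E = (g x / 2)%:E * ((e *+ 2) ^+ n)%:E)%E.
    by rewrite -muB; exact: integral_cst.
  by rewrite -EFinM lte_fin mulr_gt0// ?divr_gt0// exprn_gt0// pmulrn_lgt0.
apply: ge0_le_integral => //.
- by move=> t _; rewrite lee_fin divr_ge0// ltW.
- by apply: (measurable_funS _ _ mg) => //; exact: measurable_tcube.
- by move=> t /BP[_ /ltW]; rewrite lee_fin.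
Qed.

Lemma dominated_rint (g_ : nat -> 'rV[R]_n -> R) g (M : R) :
  (forall k, tame (g_ k)) ->
  (forall k x, cube x -> `|g_ k x| <= M) ->
  (forall x, cube x -> g_ ^~ x @ \oo --> g x) ->
  tame g /\ rint (g_ k) @[k --> \oo] --> rint g.
Proof.
move=> tg gM gg.
have mg : measurable_fun (@tcube R n) (g \o row).
  apply: (measurable_fun_cvg (h := fun k => g_ k \o row)) => [k|t /tcubeP ct]; last exact: gg.
  by case: (tg k).
have tg' : tame g.
  split=> //; exists M => x cx.
  have /cvg_norm cn := gg x cx.
  by apply: (cvgr_to_le cn); apply: nearW => k; exact: gM.
split=> //.
have [|||||_ _] := @dominated_convergence _ _ _ mu _ (@measurable_tcube R n)
  (fun k t => (g_ k (row t))%:E) (fun t => (g (row t))%:E) (fun=> M%:E).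
- by move=> k; apply/measurable_EFinP; case: (tg k).
- by apply/measurable_EFinP.
- apply: aeW => t /tcubeP ct; apply: cvg_EFin; last exact: gg.
  exact: nearW.
- exact: (tame_integrable (tame_cst M)).
- by apply: aeW => t k /tcubeP ct; rewrite lee_fin gM.
move=> h; rewrite /rint; apply: fine_cvg.
rewrite -/(rint g) -cube_integral_rint// cube_integralE.
by under eq_cvg do rewrite cube_integralE.
Qed.

Lemma row_upd j a (t : n.-tuple T) : row (upd j a t) = set_coord j a (row t).
Proof. by apply/rowP => i; rewrite !mxE tnth_mktuple. Qed.

Lemma set_coord_cube j a x : cube x -> - pi < a < pi -> cube (set_coord j a x).
Proof. by move=> cx ca i; rewrite mxE; case: ifP. Qed.

Local Notation Ipi := (`]- pi, pi[%classic : set R).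

Lemma rint_slice0 g j : tame g ->
  (forall x, cube x ->
     (\int[leb]_(a in Ipi) (g (set_coord j a x))%:E = 0)%E) ->
  rint g = 0.
Proof.
case=> mg [M gM] g0; apply: rint_eq0.
rewrite cube_integralE integral_mkcond.
pose h : n.-tuple T -> R := (g \o row) \_ (@tcube R n).
rewrite (eq_integral (EFin \o h)); last first.
  by move=> t _; rewrite /h /= !patchE; case: ifP.
have bh : bounded_on_cube h.
  split.
  - by apply/(measurable_restrictT _ _).1 => //; exact: measurable_tcube.
  - exists `|M| => t; rewrite /h patchE; case: ifPn => [|_]; last by rewrite normr0.
    rewrite inE => /tcubeP ct; apply: le_trans (gM _ ct) (ler_norm _).
  - by move=> t nt; rewrite /h patchE memNset.
apply: (integral_slice0 (j := j) bh) => t.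
have [ct|nt] := pselect (forall i, i != j -> - pi < tnth t i < pi).
  have c0 : cube (row (upd j 0 t)).
    move=> i; rewrite mxE tnth_mktuple; case: ifPn => [_|/ct//].
    by rewrite oppr_lt0 pi_gt0.
  rewrite -[RHS](g0 _ c0) [RHS]integral_mkcond; apply: eq_integral => a _.
  have E : set_coord j a (row (upd j 0 t)) = row (upd j a t).
    by rewrite !row_upd; apply/rowP => i; rewrite !mxE; case: (i == j).
  rewrite /h !patchE E; have [aI|aI] := boolP (a \in Ipi); last first.
    rewrite memNset// => /(_ j); rewrite tnth_mktuple eqxx => aI'.
    by rewrite notin_setE in aI; apply: aI.
  rewrite mem_set// => i; rewrite tnth_mktuple; case: ifPn => [_|/ct]; last by rewrite /= in_itv.
  by rewrite inE in aI.
apply: integral0_eq => a _; rewrite /h patchE memNset// => cu; apply: nt => i ij.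
by have := cu i; rewrite tnth_mktuple (negbTE ij) /= in_itv.
Qed.
End cube_integration.

(** * Periodic primitives *)

Section periodic_slices.
Context (R : realType).
Local Notation leb := (@lebesgue_measure R).
Local Notation Ipi := (`]- pi, pi[%classic : set R).
Implicit Types h k : R -> R.

(** Partial derivatives on the cube are prescribed only inside it, and take
    arbitrary values on the faces.  The witness [k] is the continuous extension
    of [h'] to the closed interval, to which the fundamental theorem of calculus
    applies. *)
Definition periodic_derivative h h' := exists k : R -> R,
  [/\ {within `[- pi, pi], continuous h}, {within `[- pi, pi], continuous k},
      h (- pi) = h pi &
      forall a, - pi < a < pi -> is_derive a 1 h (k a) /\ h' a = k a].

Lemma Npi_lt_pi : - pi < pi :> R.
Proof. by rewrite gtrN ?pi_gt0. Qed.

Lemma integral_periodic_derivative h h' : periodic_derivative h h' ->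
  (\int[leb]_(a in Ipi) (h' a)%:E = 0)%E.
Proof.
case=> k [ch ck hpi dh].
have -> : (\int[leb]_(a in Ipi) (h' a)%:E = \int[leb]_(a in Ipi) (k a)%:E)%E.
  apply: eq_integral => a; rewrite inE/= in_itv/= => /dh[_ ->]//.
have mk : measurable_fun (`[- pi, pi]%classic : set R) (fun a => (k a)%:E).
  apply/measurable_EFinP; apply: subspace_continuous_measurable_fun => //.
apply: (etrans (@integral_itv_bndo_bndc R (BRight (- pi)) pi (fun a => (k a)%:E) _)).
  by apply: (measurable_funS _ _ mk) => //; exact: subset_itv_oo_cc.
apply: (etrans (@integral_itv_obnd_cbnd R (- pi) (BRight pi) (fun a => (k a)%:E) _)).
  by apply: (measurable_funS _ _ mk) => //; exact: subset_itv_oc_cc.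
have [_ hr hl] := (continuous_within_itvP _ Npi_lt_pi).1 ch.
rewrite (@continuous_FTC2 _ k h _ _ Npi_lt_pi ck).
- by rewrite hpi subee.
- by split=> // a; rewrite in_itv/= => /dh[[]].
- move=> a; rewrite in_itv/= => /dh[da _]; rewrite derive1E; exact: derive_val.
Qed.

Lemma periodic_derivativeM h1 h1' h2 h2' :
  periodic_derivative h1 h1' -> periodic_derivative h2 h2' ->
  periodic_derivative (fun a => h1 a * h2 a) (fun a => h1' a * h2 a + h1 a * h2' a).
Proof.
move=> [k1 [ch1 ck1 p1 d1]] [k2 [ch2 ck2 p2 d2]].
exists (fun a => k1 a * h2 a + h1 a * k2 a); split.
- by move=> x; apply: continuousM; [exact: ch1|exact: ch2].
- move=> x; apply: cvgD; apply: cvgM;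
    by [exact: ch1|exact: ch2|exact: ck1|exact: ck2].
- by rewrite p1 p2.
- move=> a ca; have [? ->] := d1 _ ca; have [? ->] := d2 _ ca; split=> //.
  apply: (is_derive_eq (is_deriveM (f := h1) (g := h2) _ _)).
  by rewrite /GRing.scale/=; ring.
Qed.

Lemma periodic_derivative_smooth h k :
  (forall a : R, is_derive a 1 h (k a)) -> continuous k -> h (- pi) = h pi ->
  periodic_derivative h k.
Proof.
move=> dh ck p; exists k; split => //.
- apply: derivable_within_continuous => a _; by have [] := dh a.
- exact: continuous_subspaceT.
Qed.

End periodic_slices.

Section divergence.
Context (R : realType) (n : nat).
Implicit Types (g : 'rV[R]_n -> R) (j : 'I_n).

Definition has_periodic_partial j g g' := forall x, cube x ->
  periodic_derivative (fun a => g (set_coord j a x)) (fun a => g' (set_coord j a x)).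

Lemma rint_periodic_partial j g g' : tame g' -> has_periodic_partial j g g' ->
  rint g' = 0.
Proof.
move=> tg dg; apply: (rint_slice0 (j := j)) => // x cx.
exact: integral_periodic_derivative (dg x cx).
Qed.

Lemma has_periodic_partialM j g1 g1' g2 g2' :
  has_periodic_partial j g1 g1' -> has_periodic_partial j g2 g2' ->
  has_periodic_partial j (fun x => g1 x * g2 x) (fun x => g1' x * g2 x + g1 x * g2' x).
Proof. by move=> d1 d2 x cx; apply: periodic_derivativeM; [exact: d1|exact: d2]. Qed.

End divergence.

(** * Functions that are regular up to the boundary *)

Lemma cvg_to_within (T : Type) (V : topologicalType) (F : set_system T) (phi : T -> V) (y : V) (P : set V) :
  Filter F -> phi @ F --> y -> (\forall a \near F, P (phi a)) -> phi @ F --> within P (nbhs y).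
Proof.
move=> FF h hP A hA; have := h _ hA; rewrite !nbhs_simpl/= => h'.
by apply: filterS2 hP h' => a; rewrite /= => ? /(_ _); apply.
Qed.

Section regular_functions.
Context (R : realType) (n : nat).
Implicit Types (f g : 'rV[R]_n -> R) (x y : 'rV[R]_n) (j : 'I_n).

Lemma sub_cube_closed x : cube x -> closed_cube x.
Proof. by move=> cx i; have /andP[? ?] := cx i; rewrite !ltW. Qed.

Lemma compact_closed_cube : compact (@closed_cube R n).
Proof.
have -> : @closed_cube R n =
    [set x : 'rV[R]_n | forall i, (`[- pi, pi]%classic : set R) (x ord0 i)].
  by apply/seteqP; split => x cx i; have := cx i; rewrite /= in_itv.
by apply: (@rV_compact R n (fun=> `[- pi, pi]%classic)) => i; exact: segment_compact.
Qed.

(** Every point of the closed cube is approached from inside the cube along the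
    segment from the origin; limits at the boundary are therefore unique, and
    estimates extend to the faces by continuity. *)
Lemma cvg_scale_within x : closed_cube x ->
  (fun r : R => r *: x) @ 1^'- --> within (@cube R n) (nbhs x).
Proof.
move=> cx; apply: cvg_to_within.
  apply: cvg_at_left_filter; rewrite -[X in _ --> X]scale1r.
  exact: scalel_continuous.
near=> r => i; rewrite !mxE.
have r0 : 0 < r by near: r; apply: nbhs_left_gt.
have r1 : r < 1 by near: r; exact: nbhs_left_lt.
have /andP[x1 x2] := cx i; have p0 := pi_gt0 R.
have [x0|x0] := leP 0 (x 0 i); apply/andP; split.
- by apply: (@lt_le_trans _ _ 0); rewrite ?oppr_lt0// mulr_ge0// ltW.
- by apply: (@le_lt_trans _ _ (r * pi)); rewrite ?ler_pM2l// gtr_pMl.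
- apply: (@lt_le_trans _ _ (r * - pi)); rewrite ?ler_pM2l//.
  by rewrite mulrN ltrN2 gtr_pMl.
- by apply: (@le_lt_trans _ _ 0) => //; rewrite pmulr_rle0// ltW.
Unshelve. all: by end_near. Qed.

Lemma within_cube_proper x : closed_cube x ->
  ProperFilter (within (@cube R n) (nbhs x)).
Proof.
move=> cx; apply: Build_ProperFilter_ex => A /(cvg_scale_within cx) h.
by have [y Ay] := filter_ex h; exists y.
Qed.

Definition extends_to_boundary g :=
  forall x, closed_cube x -> cvg (g @ within (@cube R n) (nbhs x)).

(** The cube is open, so at an interior point the limit is taken along all
    neighbourhoods; as these contain the point, the limit is the value there. *)
Lemma extends_cont_cube g : extends_to_boundary g -> cont_cube g.
Proof.
move=> eg x cx.
have /cvg_ex[l gl] := eg x (sub_cube_closed cx).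
have gl' : g @ x --> l.
  move=> A /gl; rewrite !nbhs_simpl/= /within/= => h.
  have := open_nbhs_nbhs (conj (open_cube (n := n)) cx).
  by apply: filterS2 h => y cA /cA.
suff gxl : g x = l by rewrite -gxl in gl'; exact: gl'.
apply/eqP; rewrite -subr_eq0 -normr_le0; apply/ler_addgt0Pr => e e0.
apply: ltW; rewrite add0r distrC.
have /nbhs_singleton/= h : \forall y \near x, `|l - g y| < e by exact: (cvgr_dist_lt g l gl').
exact: h.
Qed.

(** [g] is bounded near each point of the closed cube, which is compact. *)
Lemma extends_bounded g : extends_to_boundary g ->
  exists M : R, forall x, cube x -> `|g x| <= M.
Proof.
move=> eg; have /compact_near_coveringP cc := compact_closed_cube.
have := cc R (pinfty_nbhs R) (fun M y => cube y -> `|g y| <= M) _.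
case.
  move=> x /eg /cvg_ex[l gl].
  have h : \forall y \near within (@cube R n) (nbhs x), `|g y| < `|l| + 1.
    apply: (cvgr_lt `|l|); first exact: (cvg_norm gl).
    by rewrite ltrDl.
  exists ([set y | cube y -> `|g y| < `|l| + 1], [set M | `|l| + 1 < M]) => /=.
    split; first exact: h.
    exact: nbhs_pinfty_gt.
  by move=> [y M] /= [gy lM] cy; apply: ltW; apply: lt_trans lM; exact: gy.
move=> M [_ hM]; exists (M + 1) => x cx; apply: (hM (M + 1)) => //.
  by rewrite ltrDl.
exact: sub_cube_closed.
Qed.

Lemma extends_tame g : extends_to_boundary g -> tame g.
Proof.
move=> eg; split; last exact: extends_bounded.
by apply: cont_cube_measurable; exact: extends_cont_cube.
Qed.

Lemma continuous_extends g : {within @closed_cube R n, continuous g} ->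
  extends_to_boundary g.
Proof.
move=> /subspace_continuousP cg x cx; apply/cvg_ex; exists (g x).
move=> A /(cg x cx); rewrite !nbhs_simpl/= /within/=.
by apply: filterS => y gA cy; apply: gA; exact: sub_cube_closed.
Qed.

(** The first-order part of smoothness and periodicity, which is all that
    integration by parts needs. *)
Record regular f : Prop := Regular {
  regular_cont : {within @closed_cube R n, continuous f};
  regular_derivable : forall x j, cube x -> derivable f x (delta_mx 0 j);
  regular_partial : forall j, extends_to_boundary (partial j f);
  regular_periodic : Defs.periodic f }.

Lemma smooth_regular f : smooth_closed_cube f -> Defs.periodic f -> regular f.
Proof.
move=> [cf sf] pf; split => //.
- by have [+ _] := sf [::].
- by move=> j; have [_ +] := sf [:: j].
Qed.

Lemma set_coord_continuous j x : continuous (fun a => set_coord j a x).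
Proof.
move=> a; apply/cvg_ballP => e e0; near=> b; split => // i k; rewrite !mxE.
case: ifP => _; last exact: ballxx.
by near: b; exists e.
Unshelve. all: by end_near. Qed.

Lemma is_derive_slice f j x a : derivable f (set_coord j a x) (delta_mx 0 j) ->
  is_derive a 1 (fun b => f (set_coord j b x)) (partial j f (set_coord j a x)).
Proof.
set y := set_coord j a x => df.
have E : (fun h : R => h^-1 *: (((fun b => f (set_coord j b x)) \o shift a) (h *: (1 : R))
      - f (set_coord j a x))) =
    (fun h => h^-1 *: ((f \o shift y) (h *: delta_mx 0 j) - f y)).
  apply/funext => h /=; congr (_ *: (f _ - _)).
  apply/rowP => i; rewrite !mxE/= /GRing.scale/= mulr1.
  by case: (i == j); rewrite ?mulr1// mulr0 add0r.
by split; rewrite /partial /derivable /derive E.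
Qed.


Lemma set_coord_closed j a x : closed_cube x -> - pi <= a <= pi ->
  closed_cube (set_coord j a x).
Proof. by move=> cx ca i; rewrite mxE; case: ifP. Qed.

Lemma slice_continuous f j x : cube x -> {within @closed_cube R n, continuous f} ->
  {within `[- pi, pi], continuous (fun a => f (set_coord j a x))}.
Proof.
move=> cx /subspace_continuousP cf; apply/subspace_continuousP => a /= ca.
have ca' : closed_cube (set_coord j a x).
  by apply: set_coord_closed; [exact: sub_cube_closed|rewrite in_itv/= in ca].
apply: (cvg_comp (fun b => set_coord j b x) f (G := within (@closed_cube R n)
  (nbhs (set_coord j a x)))); last exact: cf.
apply: cvg_to_within.
  by apply: cvg_trans (@set_coord_continuous j x a); apply: cvg_app; exact: cvg_within.
rewrite near_withinE; apply: nearW => b /=; rewrite in_itv/= => cb.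
by apply: set_coord_closed => //; exact: sub_cube_closed.
Qed.

(** Along a line parallel to an axis the extension of the partial derivative to the
    boundary restricts to a continuous function on the closed interval. *)
Lemma regular_periodic_partial f j : regular f ->
  has_periodic_partial j f (partial j f).
Proof.
move=> [cf df ef pf] x cx.
pose k a := boundary_ext (partial j f) (set_coord j a x).
have ccx := sub_cube_closed cx.
have kE a : - pi < a < pi -> k a = partial j f (set_coord j a x).
  move=> ca; have h := extends_cont_cube (ef j) (set_coord_cube j cx ca).
  rewrite /k /boundary_ext; apply/cvg_lim => //.
  - by apply: within_cube_proper; apply: sub_cube_closed; exact: set_coord_cube.
  - by apply: cvg_trans h; apply: cvg_app; exact: cvg_within.
have kl b (F : set_system R) : Filter F -> F --> b -> - pi <= b <= pi ->
    (\forall a \near F, - pi < a < pi) -> k @ F --> k b.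
  move=> FF Fb cb cF.
  have h : partial j f @ within (@cube R n) (nbhs (set_coord j b x)) --> k b.
    exact: (ef j (set_coord j b x) (set_coord_closed j ccx cb)).
  have h2 : (fun a => partial j f (set_coord j a x)) @ F --> k b.
    apply: (cvg_comp (fun b => set_coord j b x) (partial j f) _ h).
    apply: cvg_to_within; first exact: cvg_trans (cvg_app _ Fb) (@set_coord_continuous j x b).
    by apply: filterS cF => a ca; exact: set_coord_cube.
  apply: cvg_trans h2; apply: near_eq_cvg.
  by apply: filterS cF => a /kE.
exists k; split.
- exact: slice_continuous.
- apply/(continuous_within_itvP _ (Npi_lt_pi R)); split.
  + move=> a ca; apply: kl => //.
      by move: ca; rewrite in_itv/= => /andP[? ?]; rewrite !ltW.
    by move/near_in_itvoo : ca; apply: filterS => b; rewrite in_itv.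
  + apply: kl; first exact: cvg_at_right_filter.
      by rewrite lexx/= ltW// Npi_lt_pi.
    near=> a; apply/andP; split; first by near: a; exact: nbhs_right_gt.
    by near: a; apply: nbhs_right_lt; exact: Npi_lt_pi.
  + apply: kl; first exact: cvg_at_left_filter.
      by rewrite lexx andbT ltW// Npi_lt_pi.
    near=> a; apply/andP; split; last by near: a; exact: nbhs_left_lt.
    by near: a; apply: nbhs_left_gt; exact: Npi_lt_pi.
- exact: pf.
- move=> a ca; rewrite kE//; split=> //.
  by apply: is_derive_slice; apply: df; exact: set_coord_cube.
Unshelve. all: by end_near. Qed.

Lemma regular_tame f : regular f -> tame f.
Proof. by case=> cf _ _ _; apply: extends_tame; exact: continuous_extends. Qed.

Lemma regular_partial_tame f j : regular f -> tame (partial j f).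
Proof. by case=> _ _ ef _; exact: extends_tame. Qed.

Lemma regular_cont_cube f : regular f -> cont_cube f.
Proof. by case=> cf _ _ _; apply: extends_cont_cube; exact: continuous_extends. Qed.

(** The mean value theorem, which only applies inside the cube since nothing is
    differentiable on the faces. *)
Lemma regular_lipschitz_cube f j (L : R) : regular f ->
  (forall x, cube x -> `|partial j f x| <= L) ->
  forall x a b, cube x -> - pi < a < pi -> - pi < b < pi ->
    `|f (set_coord j a x) - f (set_coord j b x)| <= L * `|a - b|.
Proof.
move=> [cf df _ _] fL x a b cx.
wlog ab : a b / a <= b.
  move=> h ca cb; have [|/ltW ba] := leP a b; first by move=> /h; apply.
  by rewrite distrC (distrC a); exact: h.
move=> /andP[a1 a2] /andP[b1 b2].
have dh c : a <= c <= b -> is_derive c 1 (fun b => f (set_coord j b x))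
    (partial j f (set_coord j c x)).
  move=> /andP[ac cb]; apply: is_derive_slice; apply: df; apply: set_coord_cube => //.
  by rewrite (lt_le_trans a1 ac) (le_lt_trans cb b2).
have [||c cab /= E] := @MVT_segment R (fun b => f (set_coord j b x))
    (fun c => partial j f (set_coord j c x)) a b ab.
- by move=> c; rewrite in_itv/= => /andP[ac cb]; apply: dh; rewrite !ltW.
- apply: derivable_within_continuous => c; rewrite in_itv/= => /dh[]//.
rewrite distrC E normrM (distrC a) ler_wpM2r// fL//; apply: set_coord_cube => //.
move: cab; rewrite in_itv/= => /andP[ac cb].
by rewrite (lt_le_trans a1 ac) (le_lt_trans cb b2).
Qed.
End regular_functions.

(** * Antisymmetric functions vanish on the diagonals *)

Section trigonometric_inequality.
Context (R : realType).
Implicit Types t u : R.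

(** The derivative of [sin v - v * cos v] is [v * sin v], which is nonnegative. *)
Lemma mul_cos_le_sin u : 0 <= u <= pi -> u * cos u <= sin u.
Proof.
move=> /andP[u0 upi].
have dh (v : R) : is_derive v 1 (fun v => sin v - v * cos v) (v * sin v).
  apply: is_derive_eq; rewrite /GRing.scale/=; ring.
have [|v /[!in_itv]/= /andP[v0 vu]] := @MVT_segment R (fun v => sin v - v * cos v)
    (fun v => v * sin v) 0 u u0.
  by apply: derivable_within_continuous => v _; have [] := dh v.
rewrite sin0 mul0r !subr0 => E; rewrite -subr_ge0 E mulr_ge0//.
by rewrite mulr_ge0// sin_ge0_pi// v0 (le_trans vu).
Qed.

(** Doubling the angle: sin u = 2 sin (u/2) cos (u/2) >= u cos (u/2)^2, and
    cos (u/2)^2 >= 1/2 as long as cos u >= 0. *)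
Lemma half_le_sin u : 0 <= u <= pi / 2 -> u / 2 <= sin u.
Proof.
move=> /andP[u0 u2].
have p0 := pi_gt0 R.
have h4 : 0 <= u / 2 <= pi / 4 by apply/andP; split; lra.
have /mul_cos_le_sin h : 0 <= u / 2 <= pi by apply/andP; split; lra.
have cu : 0 <= cos u by apply: cos_ge0_pihalf; apply/andP; split; lra.
have c0 : 0 <= cos (u / 2) by apply: cos_ge0_pihalf; apply/andP; split; lra.
(* cos u >= 0 and cos u = 2 cos (u/2)^2 - 1. *)
have c2 : 1 <= cos (u / 2) ^+ 2 *+ 2.
  have E2 : u = u / 2 *+ 2 by rewrite mulr2n; lra.
  by move: cu; rewrite {1}E2 cos_mulr2n subr_ge0.
have -> : sin u = (sin (u / 2) * cos (u / 2)) *+ 2.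
  have E2 : u = u / 2 *+ 2 by rewrite mulr2n; lra.
  by rewrite {1}E2 sin_mulr2n mulrC.
have : u / 2 * cos (u / 2) * cos (u / 2) <= sin (u / 2) * cos (u / 2).
  exact: ler_wpM2r.
rewrite -mulrA -expr2.
have : u / 2 * 1 <= u / 2 * (cos (u / 2) ^+ 2 *+ 2).
  by rewrite ler_wpM2l//; case/andP: h4.
rewrite !mulr2n; lra.
Qed.

Lemma sqr_le_1subcos t : 0 <= t <= pi -> t ^+ 2 / 8 <= 1 - cos t.
Proof.
move=> /andP[t0 tp].
have /half_le_sin h : 0 <= t / 2 <= pi / 2 by apply/andP; split; lra.
have -> : 1 - cos t = sin (t / 2) ^+ 2 *+ 2.
  have E2 : t = t / 2 *+ 2 by rewrite mulr2n; lra.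
  rewrite {1}E2 cos_mulr2n cos2sin2.
  by rewrite !mulr2n; ring.
rewrite mulr2n; nra.
Qed.

End trigonometric_inequality.

Section antisymmetric_bound.
Context (R : realType) (n : nat).
Implicit Types (f g : 'rV[R]_n -> R) (x y : 'rV[R]_n) (i j : 'I_n).

Definition alternating_fun f :=
  forall x i j, closed_cube x -> i != j -> f (xcol i j x) = - f x.

Lemma antisymmetric_eq0 f x i j : alternating_fun f -> closed_cube x -> i != j ->
  x 0 i = x 0 j -> f x = 0.
Proof.
move=> af cx ij xij; have := af x i j cx ij.
have -> : xcol i j x = x.
  apply/rowP => k; rewrite !mxE; case: tpermP => [->|->|] //.
by move=> h; lra.
Qed.

Lemma set_coord_id j x : set_coord j (x 0 j) x = x.
Proof. by apply/rowP => i; rewrite mxE; case: eqP => // ->. Qed.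

(** On the closed cube: scale the points by [r < 1] and let [r] tend to 1. *)
Lemma regular_lipschitz f j (L : R) : regular f ->
  (forall x, cube x -> `|partial j f x| <= L) ->
  forall x a b, closed_cube x -> - pi <= a <= pi -> - pi <= b <= pi ->
    `|f (set_coord j a x) - f (set_coord j b x)| <= L * `|a - b|.
Proof.
move=> rf fL x a b cx ca cb.
have lim c : - pi <= c <= pi ->
    (fun r : R => f (r *: set_coord j c x)) @ 1^'- --> f (set_coord j c x).
  move=> cc; have cc' := set_coord_closed j cx cc.
  have /subspace_continuousP cf := regular_cont rf.
  apply: (cvg_comp (fun r : R => r *: set_coord j c x) f _ (cf _ cc')).
  apply: cvg_trans (cvg_scale_within cc') _.
  move=> A; rewrite /within/=; apply: filterS => y yA cy.
  by apply: yA; exact: sub_cube_closed.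
apply: (cvgr_to_le (cvg_norm (cvgB (lim a ca) (lim b cb)))).
near=> r.
have r0 : 0 < r by near: r; apply: nbhs_left_gt.
have r1 : r < 1 by near: r; exact: nbhs_left_lt.
have scale c : r *: set_coord j c x = set_coord j (r * c) (r *: x).
  by apply/rowP => i; rewrite !mxE; case: ifP.
have inside c : - pi <= c <= pi -> - pi < r * c < pi.
  move=> /andP[c1 c2]; have p0 := pi_gt0 R; apply/andP; split; nra.
have cx' : cube (r *: x) by move=> i; rewrite mxE; apply: inside; exact: cx.
rewrite -[leLHS]/(`|f (r *: set_coord j a x) - f (r *: set_coord j b x)|) !scale.
 apply: le_trans (regular_lipschitz_cube rf fL cx' (inside _ ca) (inside _ cb)) _.
have L0 : 0 <= L by apply: le_trans (normr_ge0 _) (fL _ cx').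
by rewrite -mulrBr normrM ler_wpM2l// gtr0_norm// ler_piMl// ltW.
Unshelve. all: by end_near. Qed.

Lemma regular_partial_bound f : regular f ->
  exists2 L : R, 0 <= L & forall j x, cube x -> `|partial j f x| <= L.
Proof.
move=> rf.
have /choice[M hM] : forall j, exists M : R, forall x, cube x -> `|partial j f x| <= M.
  by move=> j; have [] := regular_partial_tame j rf.
exists (\sum_j `|M j|) => [|j x cx]; first exact: sumr_ge0.
apply: le_trans (hM j x cx) _; rewrite (bigD1 j)//=.
by apply: le_trans (ler_norm _) _; rewrite lerDl sumr_ge0.
Qed.

(** An antisymmetric [f] vanishes where [x_i = x_j], hence is at most [L |x_i - x_j|]
    for a Lipschitz constant [L].  By periodicity it also vanishes at the corner
    [x_i = pi], [x_j = - pi], which controls the values where [x_i - x_j] is close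
    to 2 pi.  Up to a constant, both distances are dominated by the
    square root of [1 - cos (x_i - x_j)]. *)
Lemma antisymmetric_sqr_le f : regular f -> alternating_fun f ->
  exists2 K : R, 0 <= K &
    forall x i j, closed_cube x -> i != j -> f x ^+ 2 <= K * (1 - cos (x 0 i - x 0 j)).
Proof.
move=> rf af; have [L L0 fL] := regular_partial_bound rf.
have lip j := regular_lipschitz rf (fL j).
have near x i j : closed_cube x -> i != j -> `|f x| <= L * `|x 0 i - x 0 j|.
  move=> cx ij.
  have := lip i x (x 0 i) (x 0 j) cx (cx i) (cx j).
  rewrite set_coord_id [f (set_coord _ _ _)](@antisymmetric_eq0 _ _ i j)// ?subr0//.
    exact: set_coord_closed.
  by rewrite !mxE eqxx eq_sym (negbTE ij).
have far x i j : closed_cube x -> i != j -> `|f x| <= L * (pi *+ 2 - (x 0 i - x 0 j)).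
  move=> cx ij; have /andP[i1 i2] := cx i; have /andP[j1 j2] := cx j.
  have p0 := pi_gt0 R.
  have pp : - (pi : R) <= pi <= (pi : R) by apply/andP; split; lra.
  have np : - (pi : R) <= - pi <= (pi : R) by apply/andP; split; lra.
  have cz := set_coord_closed i cx np.
  (* Move x_i up to the face pi, which is identified with the face - pi, then x_j
     down to - pi, where both coordinates agree. *)
  have h1 := lip i x (x 0 i) pi cx (cx i) pp.
  have h2 := lip j (set_coord i (- pi) x) (x 0 j) (- pi) cz (cx j) np.
  rewrite set_coord_id -(regular_periodic rf) // in h1.
  rewrite [f (set_coord j (- pi) _)](@antisymmetric_eq0 _ _ i j)// in h2; last 2 first.
  - exact: set_coord_closed.
  - by rewrite !mxE eqxx (negbTE ij) eqxx.
  have E : set_coord j (x 0 j) (set_coord i (- pi) x) = set_coord i (- pi) x.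
    rewrite -[RHS](set_coord_id j); congr set_coord.
    by rewrite mxE eq_sym (negbTE ij).
  rewrite E subr0 opprK [`|_ + pi|]ger0_norm in h2; last by lra.
  rewrite (distrC (x 0 i)) [`|pi - _|]ger0_norm in h1; last by lra.
  have := ler_normD (f x - f (set_coord i (- pi) x)) (f (set_coord i (- pi) x)).
  rewrite subrK => /le_trans; apply; apply: le_trans (lerD h1 h2) _.
  by rewrite -mulrDr ler_wpM2l// mulr2n; lra.
exists (8 * L ^+ 2) => [|x i j cx ij]; first by rewrite mulr_ge0// sqr_ge0.
wlog le_ij : i j ij / x 0 j <= x 0 i.
  move=> h; have [|/ltW ji] := leP (x 0 j) (x 0 i); first exact: h.
  by rewrite -(cosN (_ - _)) opprB; apply: h; rewrite // eq_sym.
have /andP[i1 i2] := cx i; have /andP[j1 j2] := cx j.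
have conclude (m : R) : `|f x| <= L * m -> 0 <= m <= pi ->
    f x ^+ 2 <= 8 * L ^+ 2 * (1 - cos m).
  move=> fm m0; have := sqr_le_1subcos m0 => cm.
  rewrite -real_normK ?num_real//.
  have : `|f x| ^+ 2 <= (L * m) ^+ 2.
    by rewrite lerXn2r ?nnegrE// mulr_ge0//; case/andP: m0.
  rewrite exprMn => /le_trans; apply.
  have -> : L ^+ 2 * m ^+ 2 = 8 * L ^+ 2 * (m ^+ 2 / 8) by field.
  by rewrite ler_wpM2l// mulr_ge0// sqr_ge0.
have [tp|tp] := leP (x 0 i - x 0 j) pi.
  apply: conclude; last by rewrite subr_ge0 le_ij.
  by have := near x i j cx ij; rewrite [`|_ - _|]ger0_norm// subr_ge0.
have -> : cos (x 0 i - x 0 j) = cos (pi *+ 2 - (x 0 i - x 0 j)).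
  by rewrite [_ *+ 2 - _]addrC cosD2pi cosN.
apply: conclude; first exact: far.
by rewrite mulr2n; apply/andP; split; lra.
Qed.

End antisymmetric_bound.

(** * Derivatives of quotients of trigonometric functions *)

Section periodic_derivative_algebra.
Context (R : realType).
Implicit Types h k : R -> R.

Lemma periodic_derivative_cst (c : R) : periodic_derivative (fun=> c) (fun=> 0).
Proof.
by apply: periodic_derivative_smooth => // a; exact: cvg_cst.
Qed.

Lemma periodic_derivativeD h1 h1' h2 h2' :
  periodic_derivative h1 h1' -> periodic_derivative h2 h2' ->
  periodic_derivative (fun a => h1 a + h2 a) (fun a => h1' a + h2' a).
Proof.
move=> [k1 [ch1 ck1 p1 d1]] [k2 [ch2 ck2 p2 d2]].
exists (fun a => k1 a + k2 a); split.
- by move=> x; apply: cvgD; [exact: ch1|exact: ch2].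
- by move=> x; apply: cvgD; [exact: ck1|exact: ck2].
- by rewrite p1 p2.
- move=> a ca; have [? ->] := d1 _ ca; have [? ->] := d2 _ ca; split=> //.
  exact: (is_deriveD (f := h1) (g := h2)).
Qed.

Lemma periodic_derivative_ext h1 h1' h2 h2' : h1 =1 h2 -> h1' =1 h2' ->
  periodic_derivative h1 h1' -> periodic_derivative h2 h2'.
Proof. by move=> /funext-> /funext->. Qed.

Lemma periodic_derivativeZ (c : R) h h' : periodic_derivative h h' ->
  periodic_derivative (fun a => c * h a) (fun a => c * h' a).
Proof.
move=> /(periodic_derivativeM (periodic_derivative_cst c)).
by apply: periodic_derivative_ext => a; rewrite ?mul0r ?add0r.
Qed.

Lemma periodic_derivative_sum (I : Type) (r : seq I) (P : pred I) (h h' : I -> R -> R) :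
  (forall i, P i -> periodic_derivative (h i) (h' i)) ->
  periodic_derivative (fun a => \sum_(i <- r | P i) h i a)
                      (fun a => \sum_(i <- r | P i) h' i a).
Proof.
move=> dh; elim: r => [|i r IH].
  by apply: periodic_derivative_ext (periodic_derivative_cst 0) => a; rewrite big_nil.
case Pi : (P i); last first.
  by apply: periodic_derivative_ext IH => a; rewrite big_cons Pi.
by apply: periodic_derivative_ext (periodic_derivativeD (dh i Pi) IH) => a;
  rewrite big_cons Pi.
Qed.

Lemma cvg_sumr (T I : Type) (F : set_system T) (r : seq I) (P : pred I)
    (f : I -> T -> R) (l : I -> R) : Filter F ->
  (forall i, P i -> f i @ F --> l i) ->
  (fun t => \sum_(i <- r | P i) f i t) @ F --> \sum_(i <- r | P i) l i.
Proof.
move=> FF cf; elim: r => [|i r IH].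
  rewrite big_nil (_ : (fun _ => _) = fun=> 0); first exact: cvg_cst.
  by apply/funext => t; rewrite big_nil.
case Pi : (P i).
  rewrite big_cons Pi (_ : (fun _ => _) = fun t => f i t + \sum_(i <- r | P i) f i t).
    by apply: cvgD => //; exact: cf.
  by apply/funext => t; rewrite big_cons Pi.
rewrite big_cons Pi (_ : (fun _ => _) = fun t => \sum_(i <- r | P i) f i t)//.
by apply/funext => t; rewrite big_cons Pi.
Qed.

Lemma cvg_divr (T : Type) (F : set_system T) (f g : T -> R) (a b : R) : Filter F ->
  f @ F --> a -> g @ F --> b -> b != 0 -> (fun t => f t / g t) @ F --> a / b.
Proof. by move=> FF fa gb b0; apply: cvgM => //; exact: cvgV. Qed.

Lemma cvg_sqr (T : Type) (F : set_system T) (f : T -> R) (a : R) : Filter F ->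
  f @ F --> a -> (fun t => f t ^+ 2) @ F --> a ^+ 2.
Proof. by move=> FF fa; rewrite expr2; under eq_fun do rewrite expr2; exact: cvgM. Qed.

Lemma cvg_sin (T : Type) (F : set_system T) (f : T -> R) (a : R) : Filter F ->
  f @ F --> a -> (fun t => sin (f t)) @ F --> sin a.
Proof. by move=> FF fa; apply: continuous_cvg => //; exact: continuous_sin. Qed.

Lemma cvg_cos (T : Type) (F : set_system T) (f : T -> R) (a : R) : Filter F ->
  f @ F --> a -> (fun t => cos (f t)) @ F --> cos a.
Proof. by move=> FF fa; apply: continuous_cvg => //; exact: continuous_cos. Qed.

(** Both kinds of terms of the vector field below have this shape along a coordinate
    line; the assumption on [b] keeps the denominator away from 0. *)
Lemma periodic_derivative_sin_ratio (c b : R) : 1 < b ->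
  periodic_derivative (fun a => sin (a - c) / (b - cos (a - c)))
    (fun a => (cos (a - c) * (b - cos (a - c)) - sin (a - c) ^+ 2) /
              (b - cos (a - c)) ^+ 2).
Proof.
move=> b1; have d0 a : b - cos (a - c) != 0 by rewrite gt_eqF//; have := cos_le1 (a - c); lra.
apply: periodic_derivative_smooth.
- move=> a.
  have ds : is_derive a (1 : R) (fun a => sin (a - c)) (cos (a - c)).
    apply: is_derive_eq; rewrite /GRing.scale/=; ring.
  have dc : is_derive a (1 : R) (fun a => b - cos (a - c)) (sin (a - c)).
    apply: is_derive_eq; rewrite /GRing.scale/=; ring.
  have di := is_deriveV (f := fun a => b - cos (a - c)) (d0 a) dc.
  apply: (is_derive_eq (is_deriveM (f := fun a => sin (a - c))
    (g := fun a => (b - cos (a - c))^-1) ds di)).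
  rewrite /GRing.scale/=; field; exact: d0.
- move=> a; have ca : (fun x : R => x - c) @ a --> a - c by apply: cvgB; [exact: cvg_id|exact: cvg_cst].
  have cc : (fun x : R => b - cos (x - c)) @ a --> b - cos (a - c).
    by apply: cvgB; [exact: cvg_cst|exact: cvg_cos].
  apply: cvg_divr; last by rewrite sqrf_eq0.
    apply: cvgB; last by apply: cvg_sqr; exact: cvg_sin.
    by apply: cvgM => //; exact: cvg_cos.
  exact: cvg_sqr.
- have -> : pi - c = (- pi - c) + pi *+ 2 by rewrite mulr2n; ring.
  by rewrite sinD2pi cosD2pi.
Qed.
End periodic_derivative_algebra.

(** * The regularised logarithmic gradient of the ground state *)

Section ratio_bounds.
Context (R : realType).
Implicit Types N s c e u K : R.

(** This estimate and the next bound [u F] and [u^2 div F] uniformly in [e] for a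
    function [u] with [u^2 <= K * N], where [N] is the denominator of [F] at
    [e = 0] and [s], [c] stand for a sine and a cosine. *)
Lemma sqr_ratio_le N s e u K : 0 <= N -> 0 < e -> s ^+ 2 <= 2 * N ->
  u ^+ 2 <= K * N -> 0 <= K -> (u * (s / (N + e))) ^+ 2 <= 2 * K.
Proof.
move=> N0 e0 sN uN K0; have D0 : 0 < N + e by rewrite ltr_wpDl.
have D2 : 0 < (N + e) ^+ 2 by rewrite exprn_gt0.
rewrite mulrA exprMn exprVn exprMn ler_pdivrMr//.
have : u ^+ 2 * s ^+ 2 <= (K * N) * (2 * N) by rewrite ler_pM ?sqr_ge0.
have : K * (N ^+ 2) <= K * (N + e) ^+ 2.
  by rewrite ler_wpM2l// lerXn2r ?nnegrE ?lerDl// ltW.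
lra.
Qed.

Lemma norm_dratio_le N s c e u K : 0 <= N -> 0 < e -> s ^+ 2 <= 2 * N ->
  `|c| <= 1 -> u ^+ 2 <= K * N -> 0 <= K ->
  `|u ^+ 2 * ((c * (N + e) - s ^+ 2) / (N + e) ^+ 2)| <= 3 * K.
Proof.
move=> N0 e0 sN c1 uN K0; have D0 : 0 < N + e by rewrite ltr_wpDl.
have D2 : 0 < (N + e) ^+ 2 by rewrite exprn_gt0.
have s0 := sqr_ge0 s; have u0 := sqr_ge0 u.
rewrite mulrA normrM normfV (gtr0_norm D2) ler_pdivrMr// normrM (ger0_norm u0).
have h : `|c * (N + e) - s ^+ 2| <= 3 * (N + e).
  move: c1; rewrite !ler_norml => /andP[? ?]; apply/andP; split; nra.
have : u ^+ 2 * `|c * (N + e) - s ^+ 2| <= (K * N) * (3 * (N + e)).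
  by rewrite ler_pM.
move=> /le_trans; apply.
have : K * N * (N + e) <= K * (N + e) * (N + e).
  by apply: ler_wpM2r; [exact: ltW|apply: ler_wpM2l => //; rewrite lerDl ltW].
rewrite expr2; lra.
Qed.

Lemma norm_le_of_sqr u K : u ^+ 2 <= K -> `|u| <= 1 + K.
Proof. by rewrite ler_norml => uK; apply/andP; split; nra. Qed.

Lemma sin_sqr_le (t : R) : sin t ^+ 2 <= 2 * (1 - cos t).
Proof. by rewrite sin2cos2; have := cos_le1 t; have := cos_geN1 t; nra. Qed.

Lemma norm_cos_le1 (t : R) : `|cos t| <= 1.
Proof. by rewrite ler_norml cos_geN1 cos_le1. Qed.

(** The difference of the two sides is
    [(2 - cos a - cos b)^2 / 2 + (sin a + sin b)^2 / 2]. *)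
Lemma one_sub_cosB_le (a b : R) :
  1 - cos (a - b) <= 2 * ((1 - cos a) + (1 - cos b)).
Proof.
rewrite cosB; have := cos2Dsin2 a; have := cos2Dsin2 b.
have := sqr_ge0 (sin a + sin b); have := sqr_ge0 (2 - cos a - cos b); nra.
Qed.

End ratio_bounds.

Section vector_field.
Context (R : realType) (n : nat) (al : R).
Implicit Types (f : 'rV[R]_n -> R) (x : 'rV[R]_n) (i j : 'I_n) (e : R).

(** Twice the sum of the [sin (x_i / 2) ^+ 2].  Full angles make the vector field
    visibly 2 pi-periodic. *)
Definition cosum x : R := \sum_i (1 - cos (x 0 i)).

(** For [e = 0] this is the cotangent of [t / 2], and it has no pole for [e > 0]. *)
Definition cot_half e (t : R) : R := sin t / (1 - cos t + e).

Definition dcot_half e (t : R) : R :=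
  (cos t * (1 - cos t + e) - sin t ^+ 2) / (1 - cos t + e) ^+ 2.

(** For [e = 0], the [j]-th component of the gradient of
    log |prod_(k < l) sin ((x_k - x_l) / 2)| - al * log (cosum x). *)
Definition ground_field e j x : R :=
  2^-1 * (\sum_(i | i != j) cot_half e (x 0 j - x 0 i)) -
  al * (sin (x 0 j) / (cosum x + e)).

Definition dground_field e j x : R :=
  2^-1 * (\sum_(i | i != j) dcot_half e (x 0 j - x 0 i)) -
  al * ((cos (x 0 j) * (cosum x + e) - sin (x 0 j) ^+ 2) / (cosum x + e) ^+ 2).

Lemma one_sub_cos_ge0 (t : R) : 0 <= 1 - cos t.
Proof. by rewrite subr_ge0 cos_le1. Qed.

Lemma cosum_ge0 x : 0 <= cosum x.
Proof. by apply: sumr_ge0 => i _; exact: one_sub_cos_ge0. Qed.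

Lemma le_cosum x i : 1 - cos (x 0 i) <= cosum x.
Proof.
rewrite /cosum (bigD1 i)//= lerDl; apply: sumr_ge0 => k _; exact: one_sub_cos_ge0.
Qed.

Lemma ground_periodic_partial e j : 0 < e ->
  has_periodic_partial j (ground_field e j) (dground_field e j).
Proof.
move=> e0 x _.
have c0 : 0 <= \sum_(i | i != j) (1 - cos (x 0 i)).
  by apply: sumr_ge0 => i _; exact: one_sub_cos_ge0.
set c := \sum_(i | i != j) _ in c0.
have SE a : cosum (set_coord j a x) + e = (1 + c + e) - cos (a - 0).
  rewrite subr0 /cosum (bigD1 j)//= mxE eqxx.
  rewrite (eq_bigr (fun i => 1 - cos (x 0 i))) -/c; first by ring.
  by move=> i /negbTE ij; rewrite mxE ij.
have b1 : 1 < 1 + e by rewrite ltrDl.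
have b2 : 1 < 1 + c + e by rewrite -addrA ltrDl ltr_wpDl.
have h1 := periodic_derivativeZ 2^-1 (@periodic_derivative_sum R _ (index_enum _)
  (fun i => i != j) _ _ (fun i _ => periodic_derivative_sin_ratio (x 0 i) b1)).
have h2 := periodic_derivativeZ (- al) (periodic_derivative_sin_ratio 0 b2).
apply: periodic_derivative_ext (periodic_derivativeD h1 h2) => a.
  rewrite /ground_field SE !mxE eqxx mulNr subr0; congr (_ * _ - _).
  apply: eq_bigr => i /negbTE ij; rewrite mxE ij /cot_half; congr (_ / _); ring.
rewrite /dground_field SE !mxE eqxx mulNr subr0; congr (_ * _ - _).
apply: eq_bigr => i /negbTE ij; rewrite mxE ij /dcot_half.
by rewrite (_ : 1 - cos (a - x 0 i) + e = 1 + e - cos (a - x 0 i))//; ring.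
Qed.

(** Stated along an arbitrary filter, so that the next two lemmas give both the
    continuity of the field in [x] for fixed [e] and its convergence as [e] tends
    to 0 for fixed [x]. *)
Section ground_limits.
Context (T : Type) (F : set_system T) (FF : Filter F).
Variables (X : T -> 'rV[R]_n) (E : T -> R) (x : 'rV[R]_n) (e : R).
Hypothesis cX : forall i, (fun t => X t 0 i) @ F --> x 0 i.
Hypothesis cE : E @ F --> e.
Hypothesis N0 : forall i j, i != j -> 1 - cos (x 0 j - x 0 i) + e != 0.
Hypothesis S0 : cosum x + e != 0.

Let cN i j : (fun t => 1 - cos (X t 0 j - X t 0 i) + E t) @ F -->
  1 - cos (x 0 j - x 0 i) + e.
Proof.
apply: cvgD => //; apply: cvgB; first exact: cvg_cst.
by apply: cvg_cos; exact: cvgB.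
Qed.

Let cS : (fun t => cosum (X t) + E t) @ F --> cosum x + e.
Proof.
apply: cvgD => //; apply: cvg_sumr => i _; apply: cvgB; first exact: cvg_cst.
exact: cvg_cos.
Qed.

Lemma cvg_ground_field j : (fun t => ground_field (E t) j (X t)) @ F --> ground_field e j x.
Proof.
apply: cvgB; apply: cvgM; try exact: cvg_cst.
  apply: cvg_sumr => i ij; apply: cvg_divr; [|exact: cN|exact: N0].
  by apply: cvg_sin; exact: cvgB.
by apply: cvg_divr => //; exact: cvg_sin.
Qed.

Lemma cvg_dground_field j : (fun t => dground_field (E t) j (X t)) @ F --> dground_field e j x.
Proof.
apply: cvgB; apply: cvgM; try exact: cvg_cst.
  apply: cvg_sumr => i ij; apply: cvg_divr; last by rewrite sqrf_eq0 N0.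
    apply: cvgB; last by apply: cvg_sqr; apply: cvg_sin; exact: cvgB.
    by apply: cvgM => //; apply: cvg_cos; exact: cvgB.
  exact: cvg_sqr.
apply: cvg_divr; last by rewrite sqrf_eq0.
  apply: cvgB; last by apply: cvg_sqr; exact: cvg_sin.
  by apply: cvgM => //; exact: cvg_cos.
exact: cvg_sqr.
Qed.
End ground_limits.

Lemma continuous_tame (g : 'rV[R]_n -> R) : continuous g -> tame g.
Proof.
by move=> cg; apply: extends_tame; apply: continuous_extends; exact: continuous_subspaceT.
Qed.

Lemma ground_tame e j : 0 < e -> tame (ground_field e j) /\ tame (dground_field e j).
Proof.
move=> e0.
have N0 x i k : i != k -> 1 - cos (x 0 k - x 0 i) + e != 0.
  by move=> _; rewrite gt_eqF// ltr_wpDl// one_sub_cos_ge0.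
have S0 x : cosum x + e != 0 by rewrite gt_eqF// ltr_wpDl// cosum_ge0.
have cX x i : (fun y : 'rV[R]_n => y 0 i) @ x --> x 0 i by exact: coord_continuous.
split; apply: continuous_tame => x.
  by apply: (@cvg_ground_field _ (nbhs x) _ id (fun=> e) x e) => //; first [exact: cX|exact: cvg_cst|exact: N0|exact: S0].
by apply: (@cvg_dground_field _ (nbhs x) _ id (fun=> e) x e) => //; first [exact: cX|exact: cvg_cst|exact: N0|exact: S0].
Qed.

(** Completing the square: the integrand is a sum of squares plus the divergence of
    [f^2 F], which integrates to 0. *)
Lemma ground_integral_inequality e f : 0 < e -> regular f ->
  0 <= rint (fun x => \sum_j partial j f x ^+ 2) +
       rint (fun x => f x ^+ 2 * \sum_j (dground_field e j x + ground_field e j x ^+ 2)).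
Proof.
move=> e0 rf.
have tf := regular_tame rf; have tp j := regular_partial_tame j rf.
have tF j := (ground_tame j e0).1; have tF' j := (ground_tame j e0).2.
pose div j x := (partial j f x * f x + f x * partial j f x) * ground_field e j x +
   f x * f x * dground_field e j x.
have tdiv j : tame (div j).
  by apply: tameD; apply: tameM => //; [apply: tameD|]; exact: tameM.
have div0 j : rint (div j) = 0.
  apply: (rint_periodic_partial (j := j) (g := fun x => f x * f x * ground_field e j x)) => //.
  apply: has_periodic_partialM; last exact: ground_periodic_partial.
  by apply: has_periodic_partialM; exact: regular_periodic_partial.
have tsq : tame (fun x => \sum_j (partial j f x - f x * ground_field e j x) ^+ 2).
  by apply: tame_sum => j _; apply: tameX; apply: tameB => //; exact: tameM.
rewrite -rintD; last 2 first.
- by apply: tame_sum => j _; exact: tameX.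
- by apply: tameM; [exact: tameX|apply: tame_sum => j _; apply: tameD => //; exact: tameX].
rewrite (@eq_rint _ _ _ (fun x => \sum_j (partial j f x - f x * ground_field e j x) ^+ 2 +
    \sum_j div j x)); last first.
  move=> x _; rewrite mulr_sumr -!big_split; apply: eq_bigr => j _ /=.
  by rewrite /div; ring.
rewrite rintD//; last exact: tame_sum.
rewrite [X in _ + X]rint_sum// [X in _ + X]big1 ?addr0//.
by apply: rint_ge0 => x _; apply: sumr_ge0 => j _; exact: sqr_ge0.
Qed.

End vector_field.

(** * Cotangent identities *)

Section cotangent_identities.
Context (R : realType).
Implicit Types t u v : R.

Lemma half_double t : t = t / 2 *+ 2.
Proof. by rewrite mulr2n; lra. Qed.

Lemma one_sub_cos t : 1 - cos t = 2 * sin (t / 2) ^+ 2.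
Proof.
rewrite {1}(half_double t) cos_mulr2n cos2sin2 mulr2n; ring.
Qed.

Lemma sin_half_neq0 t : 1 - cos t != 0 -> sin (t / 2) != 0.
Proof. by apply: contraNneq => s0; rewrite one_sub_cos s0 expr0n/= mulr0. Qed.

Lemma cot_half0E t : 1 - cos t != 0 -> cot_half 0 t = cos (t / 2) / sin (t / 2).
Proof.
move=> /sin_half_neq0 s0; rewrite /cot_half addr0 one_sub_cos.
rewrite {1}(half_double t) sin_mulr2n mulr2n; field; exact: s0.
Qed.

Lemma cot_half0N t : cot_half 0 (- t) = - cot_half 0 t.
Proof. by rewrite /cot_half sinN cosN mulNr. Qed.

Lemma dcot_half0E t : 1 - cos t != 0 -> dcot_half 0 t = - ((cot_half 0 t ^+ 2 + 1) / 2).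
Proof.
move=> n0; rewrite /dcot_half /cot_half addr0 sin2cos2 expr_div_n sin2cos2.
by field.
Qed.

(** The addition formula cot (a + b) (cot a + cot b) = cot a cot b - 1, at
    half angles. *)
Lemma cot_half0_triple u v :
  1 - cos u != 0 -> 1 - cos v != 0 -> 1 - cos (u + v) != 0 ->
  cot_half 0 u * cot_half 0 (u + v) - cot_half 0 u * cot_half 0 v +
  cot_half 0 v * cot_half 0 (u + v) = - 1.
Proof.
move=> u0 v0 uv0; have := sin_half_neq0 uv0.
rewrite !cot_half0E// mulrDl sinD cosD.
move: (sin_half_neq0 u0) (sin_half_neq0 v0).
move: (sin (u / 2)) (cos (u / 2)) (sin (v / 2)) (cos (v / 2)) => s c s' c' s0 s'0 d0.
by field; rewrite s0 s'0 d0.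
Qed.

Lemma cot_half0_sinB u v : 1 - cos (u - v) != 0 ->
  cot_half 0 (u - v) * (sin u - sin v) = cos u + cos v.
Proof.
have [m [a [-> ->]]] : exists m a, u = m + a /\ v = m - a.
  by exists ((u + v) / 2), ((u - v) / 2); split; lra.
have E : m + a - (m - a) = a *+ 2 by rewrite mulr2n; lra.
rewrite E => n0; have := sin_half_neq0 n0; rewrite cot_half0E//.
have -> : a *+ 2 / 2 = a by rewrite mulr2n; lra.
move=> s0; rewrite sinD sinB cosD cosB; field; exact: s0.
Qed.
End cotangent_identities.

Section symmetrisation.
Context (R : realType) (n : nat).

(** Expanding the squares gives the sum of [a j i * a j k] over all triples.  Averaging
    over the cyclic permutations of a triple of distinct indices replaces the
    summand by - 1 / 3; triples with a repetition leave the sum of the [a j i ^+ 2].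
    The bound loses a multiple of [n], from triples of equal indices. *)
Lemma sum_sqr_of_triples (a : 'I_n -> 'I_n -> R) :
  (forall i j, a j i = - a i j) ->
  (forall i j k, i != j -> j != k -> i != k ->
     a j i * a j k + a i j * a i k + a k i * a k j = - 1) ->
  3 * (\sum_j (\sum_i a j i) ^+ 2) <=
    - n%:R ^+ 3 + 3 * (\sum_j \sum_i a j i ^+ 2) + 3 * n%:R ^+ 2.
Proof.
move=> aN aT.
have a0 i : a i i = 0 by have := aN i i; lra.
pose t j i k := a j i * a j k.
have sq : \sum_j (\sum_i a j i) ^+ 2 = \sum_j \sum_i \sum_k t j i k.
  apply: eq_bigr => j _; rewrite expr2 mulr_suml; apply: eq_bigr => i _.
  by rewrite mulr_sumr.
have e1 : \sum_j \sum_i \sum_k t j i k = \sum_j \sum_i \sum_k t i j k.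
  by rewrite exchange_big.
have e2 : \sum_j \sum_i \sum_k t j i k = \sum_j \sum_i \sum_k t k i j.
  rewrite exchange_big /= [RHS]exchange_big /=; apply: eq_bigr => i _.
  by rewrite exchange_big.
have -> : 3 * (\sum_j (\sum_i a j i) ^+ 2) =
    \sum_j \sum_i \sum_k (t j i k + t i j k + t k i j).
  under [RHS]eq_bigr do under eq_bigr do rewrite !big_split /=.
  under [RHS]eq_bigr do rewrite !big_split /=.
  by rewrite !big_split /= -e1 -e2 -sq; ring.
(* The correction for a repeated index: it offsets the - 1 of a generic triple and
   adds the square that the repetition leaves. *)
pose d (i j : 'I_n) (r : R) := if i == j then r + 1 else 0.
have le_t j i k : t j i k + t i j k + t k i j <=
    - 1 + d i k (a j i ^+ 2) + d j i (a k j ^+ 2) + d j k (a i j ^+ 2).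
  have sqr1 (r : R) : 0 <= r ^+ 2 := sqr_ge0 r.
  rewrite /t /d; have [->|ij] := eqVneq j i.
    have [->|ik] := eqVneq i k; rewrite ?a0; first by lra.
    by have := sqr1 (a k i); rewrite (aN k i) expr2; nra.
  have [E|jk] := eqVneq i k.
    by rewrite -E (negbTE ij) a0 expr2; nra.
  have [E|ki] := eqVneq j k.
    by rewrite -E a0 (aN i j) expr2; nra.
  by rewrite (aT i j k)//; [lra|rewrite eq_sym].
have sumd (b : 'I_n -> R) i : \sum_k d i k (b k) = b i + 1.
  rewrite (bigD1 i)//= /d eqxx big1 ?addr0// => k /negbTE ki.
  by rewrite eq_sym ki.
apply: (@le_trans _ _ (\sum_j \sum_i \sum_k
    (- 1 + d i k (a j i ^+ 2) + d j i (a k j ^+ 2) + d j k (a i j ^+ 2)))).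
  by apply: ler_sum => j _; apply: ler_sum => i _; apply: ler_sum => k _; exact: le_t.
have c1 : \sum_(j < n) \sum_(i < n) (1 : R) = n%:R ^+ 2.
  under eq_bigr do rewrite sumr_const card_ord.
  by rewrite sumr_const card_ord -[LHS]mulr_natr expr2.
have s1 : \sum_j \sum_i \sum_k d i k (a j i ^+ 2) = \sum_j \sum_i a j i ^+ 2 + n%:R ^+ 2.
  rewrite -c1 -big_split; apply: eq_bigr => j _; rewrite -big_split.
  by apply: eq_bigr => i _; rewrite (sumd (fun=> a j i ^+ 2)).
have s2 : \sum_j \sum_i \sum_k d j i (a k j ^+ 2) = \sum_j \sum_i a j i ^+ 2 + n%:R ^+ 2.
  rewrite -c1 -big_split; apply: eq_bigr => j _; rewrite exchange_big -big_split.
  apply: eq_bigr => i _; rewrite (sumd (fun=> a i j ^+ 2)).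
  by rewrite (aN i j) sqrrN.
have s3 : \sum_j \sum_i \sum_k d j k (a i j ^+ 2) = \sum_j \sum_i a j i ^+ 2 + n%:R ^+ 2.
  rewrite -c1 -big_split; apply: eq_bigr => j _; rewrite -big_split.
  apply: eq_bigr => i _; rewrite (sumd (fun=> a i j ^+ 2)).
  by rewrite (aN i j) sqrrN.
under eq_bigr do under eq_bigr do rewrite !big_split /= sumr_const card_ord.
under eq_bigr do rewrite !big_split /=.
rewrite !big_split /= s1 s2 s3.
have -> : \sum_(j < n) \sum_(i < n) (- 1 *+ n : R) = - n%:R ^+ 3.
  under eq_bigr do rewrite sumr_const card_ord.
  by rewrite sumr_const card_ord -[LHS]mulr_natr -[X in X * _]mulr_natr
    -[X in X * _ * _]mulr_natr; ring.
lra.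
Qed.
End symmetrisation.

(** * The ground state is a supersolution *)

(** [D] is the dimension, [S] stands for [cosum], and [Q], [A2], [W] for the three sums
    bounded in [ground_div_le].  With alpha = D^2 / 24 the terms that do
    not contain [S] sum to at most (6 D - D^3) / 24, negative from [D = 3] on, and
    those divided by [S] to at most - (D^4 / 48) / S. *)
Lemma ground_state_arith (R : realType) (D S Q A2 W : R) : 3 <= D -> 0 < S ->
  3 * A2 <= - D ^+ 3 + 3 * Q + 3 * D ^+ 2 -> W <= 2 * S ->
  - ((Q + D ^+ 2 - D) / 4) - D ^+ 2 / 24 * ((D - S) / S)
  + (D ^+ 2 / 24 + (D ^+ 2 / 24) ^+ 2) * (W / S ^+ 2) + A2 / 4
  - D ^+ 2 / 24 * ((D - 1) * (D - S) / S) <= - (D ^+ 4 / 48 / S).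
Proof.
move=> D3 S0 h3 hW.
pose z := S^-1; have z0 : 0 < z by rewrite invr_gt0.
have Wz : W / S ^+ 2 <= 2 * z.
  rewrite ler_pdivrMr ?exprn_gt0// /z (_ : 2 * S^-1 * S ^+ 2 = 2 * S)//.
  by field; rewrite gt_eqF.
have nz : (D - S) / S = D * z - 1 by rewrite mulrBl divff ?gt_eqF.
have pz : (D - 1) * (D - S) / S = (D - 1) * (D * z - 1) by rewrite -mulrA nz.
rewrite nz pz -/z.
have al0 : 0 <= D ^+ 2 / 24 + (D ^+ 2 / 24) ^+ 2.
  by rewrite addr_ge0 ?sqr_ge0// mulr_ge0// sqr_ge0.
have {}Wz := ler_wpM2l al0 Wz.
have D2 : 9 <= D ^+ 2 by nra.
have cubic : 0 <= (D ^+ 3 - 6 * D) / 24 by nra.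
have quart : 0 <= z * (D ^+ 2 / 24) * (D ^+ 2 * 5 / 12 - 2).
  apply: mulr_ge0; last by lra.
  by apply: mulr_ge0; [exact: ltW|rewrite divr_ge0// sqr_ge0].
have e1 : z * (D ^+ 2 / 24) * (D ^+ 2 * 5 / 12 - 2) =
    D ^+ 2 / 24 * (11 / 12 * (D ^+ 2 * z) - 2 * z - D ^+ 2 * z / 2) by field.
have e2 : D ^+ 4 / 48 * z = D ^+ 2 / 24 * (D ^+ 2 * z / 2) by field.
rewrite e2; rewrite e1 in quart.
move: Wz cubic quart.

lra.
Qed.

Section ground_state.
Context (R : realType) (n : nat).
Implicit Types (f : 'rV[R]_n -> R) (x : 'rV[R]_n) (i j : 'I_n).
Hypothesis n3 : (3 <= n)%N.

(** Any small multiple of [n^2] would do: the loss [alpha * n] has to stay below the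
    eigenvalue n^3 / 12, while the gain is of order [alpha * n^2]. *)
Definition alpha : R := n%:R ^+ 2 / 24.

(** The product [P] sums the cross terms of the cotangents with the gradient of
    [cosum]: pairing [(i, j)] with [(j, i)] turns each cotangent times a difference of
    sines into a sum of cosines. *)
Lemma ground_div_le x :
  (forall i j, i != j -> 1 - cos (x 0 j - x 0 i) != 0) -> 0 < cosum x ->
  \sum_j (dground_field alpha 0 j x + ground_field alpha 0 j x ^+ 2) <=
    - (n%:R ^+ 4 / 48 / cosum x).
Proof.
move=> N0 S0; set S := cosum x in S0 *; set al := alpha.
pose a j i : R := cot_half 0 (x 0 j - x 0 i).
pose w j := sin (x 0 j); pose c j := cos (x 0 j).
have aN i j : a j i = - a i j by rewrite /a -opprB cot_half0N.
have a0 j : a j j = 0 by have := aN j j; lra.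
have sumS : \sum_j c j = n%:R - S.
  by rewrite /S /cosum sumrB sumr_const card_ord /c; ring.
have fE j : ground_field al 0 j x = 2^-1 * (\sum_i a j i) - al * (w j / S).
  by rewrite /ground_field addr0 [in RHS](bigD1 j)//= a0 add0r.
have dfE j : dground_field al 0 j x = - ((\sum_i a j i ^+ 2 + n%:R - 1) / 4)
    - al * (c j / S) + al * (w j ^+ 2 / S ^+ 2).
  rewrite /dground_field addr0 -/S -/(w j) -/(c j).
  have -> : \sum_(i | i != j) dcot_half 0 (x 0 j - x 0 i) =
      - ((\sum_i a j i ^+ 2 + n%:R - 1) / 2).
    rewrite (eq_bigr (fun i => - ((a j i ^+ 2 + 1) / 2))) => [|i ij]; last first.
      by rewrite dcot_half0E// N0.
    have : \sum_i - ((a j i ^+ 2 + 1) / 2) = - ((\sum_i a j i ^+ 2 + n%:R) / 2).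
      rewrite sumrN -mulr_suml big_split /= sumr_const card_ord; congr (- (_ / _)).
    rewrite (bigD1 j)//= a0 => E; move: E; rewrite expr0n/= => E; lra.
  have S1 : S != 0 by rewrite gt_eqF.
  by field.
have h3 := @sum_sqr_of_triples R n a aN _.
have {}h3 : 3 * (\sum_j (\sum_i a j i) ^+ 2) <=
    - n%:R ^+ 3 + 3 * (\sum_j \sum_i a j i ^+ 2) + 3 * n%:R ^+ 2.
  apply: h3 => i j k ij jk ik.
  have E : x 0 j - x 0 k = (x 0 j - x 0 i) + (x 0 i - x 0 k) by ring.
  have H : a j i * a j k - a j i * a i k + a i k * a j k = - 1.
    by rewrite /a E cot_half0_triple -?E//; apply: N0; rewrite // eq_sym.
  by rewrite (aN j i) (aN i k) (aN j k) -H; ring.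
have P : \sum_j (\sum_i a j i) * w j = (n%:R - 1) * (n%:R - S).
  have P1 : \sum_j (\sum_i a j i) * w j = \sum_j \sum_i a j i * w j.
    by apply: eq_bigr => j _; rewrite mulr_suml.
  have P2 : \sum_j \sum_i a j i * w j = - \sum_j \sum_i a j i * w i.
    rewrite exchange_big /= -sumrN; apply: eq_bigr => j _; rewrite -sumrN.
    by apply: eq_bigr => i _; rewrite (aN j i); ring.
  have P3 : \sum_j \sum_i (a j i * w j - a j i * w i) =
      \sum_j \sum_i (c i + c j) - \sum_j c j *+ 2.
    rewrite -sumrB; apply: eq_bigr => j _.
    rewrite (bigD1 j)//= a0 [in RHS](bigD1 j)//=.
    rewrite (eq_bigr (fun i => c i + c j)) => [|i ij].
      by rewrite mulr2n; ring.
    by rewrite -mulrBr cot_half0_sinB ?N0// addrC.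
  move: P3.
  have -> : \sum_j \sum_i (a j i * w j - a j i * w i) = 2 * \sum_j \sum_i a j i * w j.
    under eq_bigr do rewrite sumrB.
    rewrite sumrB -[X in _ - X]opprK -P2; ring.
  have -> : \sum_j \sum_i (c i + c j) = 2 * n%:R * (n%:R - S).
    under eq_bigr do rewrite big_split /= sumr_const card_ord.
    rewrite big_split /= sumr_const card_ord sumrMnl sumS.
    by rewrite -[_ *+ n]mulr_natr -[in X in _ + X]mulr_natr; ring.
  rewrite sumrMnl sumS -P1 mulr2n => E; lra.
have W : \sum_j w j ^+ 2 <= 2 * S.
  rewrite /S /cosum mulr_sumr; apply: ler_sum => j _; exact: sin_sqr_le.
have -> : \sum_j (dground_field al 0 j x + ground_field al 0 j x ^+ 2) =
  - ((\sum_j \sum_i a j i ^+ 2 + n%:R ^+ 2 - n%:R) / 4) - al * ((n%:R - S) / S)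
  + (al + al ^+ 2) * ((\sum_j w j ^+ 2) / S ^+ 2) + (\sum_j (\sum_i a j i) ^+ 2) / 4
  - al * ((\sum_j (\sum_i a j i) * w j) / S).
  have split_j j : dground_field al 0 j x + ground_field al 0 j x ^+ 2 =
      - 4^-1 * (\sum_i a j i ^+ 2) - (n%:R - 1) / 4 - al / S * c j
      + (al + al ^+ 2) / S ^+ 2 * w j ^+ 2 + 4^-1 * (\sum_i a j i) ^+ 2
      - al / S * ((\sum_i a j i) * w j).
    by rewrite dfE fE; field; rewrite gt_eqF.
  rewrite (eq_bigr _ (fun j _ => split_j j)) !(sumrB, big_split) /= -!mulr_sumr.
  rewrite sumS sumr_const card_ord -[4^-1 *+ n]mulr_natr; field.
  by rewrite gt_eqF.
rewrite P.
have n0 : 3 <= n%:R :> R by rewrite ler_nat.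
exact: ground_state_arith.
Qed.
End ground_state.

(** * Hardy inequality for real functions *)

Section real_hardy.
Context (R : realType) (n : nat).
Implicit Types (f : 'rV[R]_n -> R) (x : 'rV[R]_n) (i j : 'I_n).
Hypothesis n2 : (2 <= n)%N.

Definition sinsum x : R := \sum_(j < n) sin (x 0 j / 2) ^+ 2.

Lemma cosumE x : cosum x = 2 * sinsum x.
Proof. by rewrite /sinsum mulr_sumr; apply: eq_bigr => i _; exact: one_sub_cos. Qed.

Lemma antisymmetric_sqr_le_cosum f K : 0 <= K ->
  (forall x i j, closed_cube x -> i != j -> f x ^+ 2 <= K * (1 - cos (x 0 i - x 0 j))) ->
  forall x, closed_cube x -> f x ^+ 2 <= 2 * K * cosum x.
Proof.
move=> K0 fK x cx.
pose i0 : 'I_n := Ordinal (leq_trans (isT : 0 < 2)%N n2).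
pose i1 : 'I_n := Ordinal n2.
apply: le_trans (fK x i0 i1 cx isT) _.
rewrite -mulrA mulrCA; apply: ler_wpM2l => //.
apply: le_trans (one_sub_cosB_le _ _) _; rewrite ler_wpM2l//.
rewrite /cosum (bigD1 i0)//= (bigD1 i1)//= lerD2l lerDl.
by apply: sumr_ge0 => i _; exact: one_sub_cos_ge0.
Qed.

(** The dominating constant for the limit [e = 0]. *)
Lemma regularised_bound f : regular f -> alternating_fun f ->
  exists M : R, forall e, 0 < e -> forall x, cube x ->
    `|f x ^+ 2 * \sum_j (dground_field (alpha R n) e j x + ground_field (alpha R n) e j x ^+ 2)| <= M.
Proof.
move=> rf af; have [K K0 fK] := antisymmetric_sqr_le rf af.
have fS := antisymmetric_sqr_le_cosum K0 fK.
set al := alpha R n.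
have al0 : 0 <= al by rewrite /al /alpha divr_ge0// sqr_ge0.
move: al al0 => al al0.
pose B := 2^-1 * (n%:R * (1 + 2 * K)) + al * (1 + 2 * (2 * K)).
pose B' := 2^-1 * (n%:R * (3 * K)) + al * (3 * (2 * K)).
exists (n%:R * (B' + B ^+ 2)) => e e0 x cx.
have ccx := sub_cube_closed cx.
have K20 : 0 <= 2 * K by rewrite mulr_ge0.
have fN j i : i != j -> f x ^+ 2 <= K * (1 - cos (x 0 j - x 0 i)).
  by move=> ij; apply: fK => //; rewrite eq_sym.
have sS j : sin (x 0 j) ^+ 2 <= 2 * cosum x.
  by apply: le_trans (sin_sqr_le _) _; rewrite ler_wpM2l// le_cosum.
have sum_le (P : pred 'I_n) (b : R) (u : 'I_n -> R) : 0 <= b ->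
    (forall i, P i -> `|u i| <= b) -> `|\sum_(i | P i) u i| <= n%:R * b.
  move=> b0 ub; apply: le_trans (ler_norm_sum _ _ _) _.
  apply: (@le_trans _ _ (\sum_(i < n) b)).
    rewrite big_mkcond; apply: ler_sum => i _; case: ifP => // Pi; exact: ub.
  by rewrite sumr_const card_ord mulr_natl.
have fF j : `|f x * ground_field al e j x| <= B.
  have -> : f x * ground_field al e j x =
      2^-1 * (\sum_(i | i != j) f x * cot_half e (x 0 j - x 0 i)) -
      al * (f x * (sin (x 0 j) / (cosum x + e))).
    by rewrite /ground_field -mulr_sumr; ring.
  apply: le_trans (ler_normB _ _) _; rewrite [`|2^-1 * _|]normrM [`|al * _|]normrM.
  rewrite (ger0_norm al0) [`|2^-1|]ger0_norm//.
  apply: lerD; rewrite ler_wpM2l//.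
    apply: sum_le; first by rewrite addr_ge0.
    move=> i ij; apply: norm_le_of_sqr; apply: sqr_ratio_le => //;
      first [exact: one_sub_cos_ge0|exact: sin_sqr_le|exact: fN].
  apply: norm_le_of_sqr; apply: sqr_ratio_le => //; first [exact: cosum_ge0|exact: fS].
have fF' j : `|f x ^+ 2 * dground_field al e j x| <= B'.
  have -> : f x ^+ 2 * dground_field al e j x =
      2^-1 * (\sum_(i | i != j) f x ^+ 2 * dcot_half e (x 0 j - x 0 i)) -
      al * (f x ^+ 2 * ((cos (x 0 j) * (cosum x + e) - sin (x 0 j) ^+ 2) /
        (cosum x + e) ^+ 2)).
    by rewrite /dground_field -mulr_sumr; ring.
  apply: le_trans (ler_normB _ _) _; rewrite [`|2^-1 * _|]normrM [`|al * _|]normrM.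
  rewrite (ger0_norm al0) [`|2^-1|]ger0_norm//.
  apply: lerD; rewrite ler_wpM2l//.
    apply: sum_le; first by rewrite mulr_ge0.
    move=> i ij; apply: norm_dratio_le => //;
      first [exact: one_sub_cos_ge0|exact: sin_sqr_le|exact: norm_cos_le1|exact: fN].
  apply: norm_dratio_le => //; first [exact: cosum_ge0|exact: norm_cos_le1|exact: fS].
rewrite mulr_sumr; apply: sum_le.
  have K00 := normr_ge0 (f x ^+ 2 * dground_field al e (Ordinal (leq_trans (isT : 0 < 2)%N n2)) x).
  by rewrite addr_ge0 ?sqr_ge0// (le_trans K00).
move=> j _; rewrite mulrDr -exprMn; apply: le_trans (ler_normD _ _) _.
apply: lerD => //; rewrite normrX lerXn2r ?nnegrE//.
exact: le_trans (normr_ge0 _) (fF j).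
Qed.

Lemma cvg_harmonic_seq : (fun k => k.+1%:R^-1 : R) @ \oo --> (0 : R).
Proof. exact: cvg_harmonic. Qed.

Lemma cvg_sinsum (T : Type) (F : set_system T) (FF : Filter F)
    (X : T -> 'rV[R]_n) (E : T -> R) x e :
  (forall i, (fun t => X t 0 i) @ F --> x 0 i) -> E @ F --> e ->
  (fun t => sinsum (X t) + E t) @ F --> sinsum x + e.
Proof.
move=> cX cE; apply: cvgD => //; apply: cvg_sumr => i _; apply: cvg_sqr.
by apply: cvg_sin; apply: cvgMr_tmp; exact: cX.
Qed.

(** The quotient is bounded by [antisymmetric_sqr_le_cosum]; it is measurable as the
    limit of the quotients with denominators [sinsum x + 1 / (k + 1)], the
    denominator itself being 0 at the origin. *)
Lemma hardy_term_tame f : regular f -> alternating_fun f ->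
  tame (fun x => f x ^+ 2 / sinsum x).
Proof.
move=> rf af; have [K K0 fK] := antisymmetric_sqr_le rf af.
have fS := antisymmetric_sqr_le_cosum K0 fK.
have s0 x : 0 <= sinsum x by apply: sumr_ge0 => i _; exact: sqr_ge0.
have fs x : closed_cube x -> f x ^+ 2 <= 4 * K * sinsum x.
  move=> cx; apply: le_trans (fS x cx) _; rewrite cosumE; lra.
pose g k x := f x ^+ 2 / (sinsum x + k.+1%:R^-1).
have [] // := @dominated_rint R n g (fun x => f x ^+ 2 / sinsum x) (4 * K).
- move=> k; apply: tameM; first by apply: tameX; exact: regular_tame.
  apply: continuous_tame => x.
  have d0 : sinsum x + k.+1%:R^-1 != 0 by rewrite gt_eqF// ltr_wpDl.
  have h : (fun y : 'rV[R]_n => sinsum y + k.+1%:R^-1) @ x --> sinsum x + k.+1%:R^-1.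
    apply: (@cvg_sinsum _ (nbhs x) _ id) => [i|]; last exact: cvg_cst.
    exact: coord_continuous.
  exact: (cvgV d0 h).
- move=> k x cx; have d0 : 0 < sinsum x + k.+1%:R^-1 by rewrite ltr_wpDl.
  rewrite ger0_norm; last by rewrite divr_ge0 ?sqr_ge0// ltW.
  rewrite ler_pdivrMr//; apply: le_trans (fs x (sub_cube_closed cx)) _.
  by rewrite ler_wpM2l ?mulr_ge0// lerDl.
- move=> x cx; have [f0|f0] := eqVneq (f x) 0.
    rewrite /g f0 expr0n/= mul0r; under eq_fun do rewrite mul0r; exact: cvg_cst.
  apply: cvg_divr; first exact: cvg_cst.
    rewrite -[X in _ --> X]addr0; apply: cvgD; first exact: cvg_cst.
    exact: cvg_harmonic_seq.
  apply: contraNneq f0 => sx0; have := fs x (sub_cube_closed cx).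
  by rewrite sx0 mulr0 => h; rewrite -sqrf_eq0 eq_le h sqr_ge0.
Qed.

(** Where [f x != 0] the coordinates are distinct, so the field converges there as
    [e] tends to 0; where [f x = 0] the integrand is 0 for every [e]. *)
Lemma real_hardy f : (3 <= n)%N -> regular f -> alternating_fun f ->
  n%:R ^+ 4 / 96 * rint (fun x => f x ^+ 2 / sinsum x) <=
  rint (fun x => \sum_j partial j f x ^+ 2).
Proof.
move=> n3 rf af; have [K K0 fK] := antisymmetric_sqr_le rf af.
have fS := antisymmetric_sqr_le_cosum K0 fK.
have [M hM] := regularised_bound rf af.
set al := alpha R n in hM.
pose q e x := f x ^+ 2 * \sum_j (dground_field al e j x + ground_field al e j x ^+ 2).
have e0 k : 0 < k.+1%:R^-1 :> R by rewrite invr_gt0.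
have tq k : tame (q k.+1%:R^-1).
  apply: tameM; first by apply: tameX; exact: regular_tame.
  apply: tame_sum => j _; have [t1 t2] := ground_tame al j (e0 k).
  by apply: tameD => //; exact: tameX.
have N0 x : cube x -> f x != 0 -> forall i j, i != j -> 1 - cos (x 0 j - x 0 i) != 0.
  move=> cx f0 i j ij; apply: contraNneq f0 => N0.
  have := fK x j i (sub_cube_closed cx); rewrite eq_sym ij N0 mulr0.
  by move=> /(_ isT) h; rewrite -sqrf_eq0 eq_le h sqr_ge0.
have S0 x : cube x -> f x != 0 -> cosum x != 0.
  move=> cx f0; apply: contraNneq f0 => S0.
  by have := fS x (sub_cube_closed cx); rewrite S0 mulr0 => h; rewrite -sqrf_eq0 eq_le h sqr_ge0.
have [tq0 lim] : tame (q 0) /\ rint (q k.+1%:R^-1) @[k --> \oo] --> rint (q 0).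
  apply: (@dominated_rint _ _ (fun k => q k.+1%:R^-1) _ M) => //.
    by move=> k x cx; exact: hM.
  move=> x cx; have [f0|f0] := eqVneq (f x) 0.
    rewrite /q f0 expr0n/= mul0r; under eq_fun do rewrite mul0r; exact: cvg_cst.
  apply: cvgM; first exact: cvg_cst.
  have h1 i j : i != j -> 1 - cos (x 0 j - x 0 i) + 0 != 0 by rewrite addr0; exact: N0.
  have h2 : cosum x + 0 != 0 by rewrite addr0 S0.
  have cx0 i : (fun _ : nat => x 0 i) @ \oo --> x 0 i by exact: cvg_cst.
  apply: cvg_sumr => j _; apply: cvgD.
    exact: (@cvg_dground_field R n al _ _ _ (fun=> x) (fun k => k.+1%:R^-1) x 0
      cx0 cvg_harmonic_seq h1 h2 j).
  apply: cvg_sqr.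
  exact: (@cvg_ground_field R n al _ _ _ (fun=> x) (fun k => k.+1%:R^-1) x 0
      cx0 cvg_harmonic_seq h1 h2 j).
have limit_ge0 : 0 <= rint (fun x => \sum_j partial j f x ^+ 2) + rint (q 0).
  apply: (cvgr_to_ge (cvgD (cvg_cst _) lim)).
  by apply: nearW => k; exact: ground_integral_inequality.
have th := hardy_term_tame rf af.
have : rint (q 0) <= rint (fun x => - (n%:R ^+ 4 / 96) * (f x ^+ 2 / sinsum x)).
  apply: le_rint => //; first exact: tameZ.
  move=> x cx; rewrite /q; have [f0|f0] := eqVneq (f x) 0.
    by rewrite f0 expr0n/= !mul0r mulr0.
  have Sx : 0 < cosum x by rewrite lt_neqAle eq_sym S0//= cosum_ge0.
  have h := ground_div_le n3 (N0 x cx f0) Sx.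
  have := ler_wpM2l (sqr_ge0 (f x)) h; rewrite -/al => /le_trans; apply.
  rewrite cosumE le_eqVlt; apply/orP; left; apply/eqP; field.
  by move: Sx; rewrite cosumE pmulr_rgt0// => /gt_eqF ->.
rewrite rintZ//; lra.
Qed.

End real_hardy.

(** * Trigonometric sums *)

Lemma cvg_prodr (R : realType) (T J : Type) (F : set_system T) (r : seq J) (P : pred J)
    (f : J -> T -> R) (l : J -> R) : Filter F ->
  (forall i, P i -> f i @ F --> l i) ->
  (fun t => \prod_(i <- r | P i) f i t) @ F --> \prod_(i <- r | P i) l i.
Proof.
move=> FF cf; elim: r => [|i r IH].
  rewrite big_nil (_ : (fun _ => _) = fun=> 1); first exact: cvg_cst.
  by apply/funext => t; rewrite big_nil.
case Pi : (P i).
  rewrite big_cons Pi (_ : (fun _ => _) = fun t => f i t * \prod_(i <- r | P i) f i t).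
    by apply: cvgM => //; exact: cf.
  by apply/funext => t; rewrite big_cons Pi.
rewrite big_cons Pi (_ : (fun _ => _) = fun t => \prod_(i <- r | P i) f i t)//.
by apply/funext => t; rewrite big_cons Pi.
Qed.

Section trigonometric_sums.
Context (R : realType) (n : nat).
Implicit Types (x : 'rV[R]_n) (i j : 'I_n) (m : 'I_n -> nat) (th : 'I_n -> R).

Definition cosprod m th x : R := \prod_i cos ((m i)%:R * x 0 i + th i).

(** The amplitudes, frequencies and phases are kept explicit because this class of
    functions is stable under partial derivatives: differentiating multiplies the
    amplitude by a frequency and advances a phase by a quarter turn. *)
Definition trigsum (I : finType) (c : I -> R) (m : I -> 'I_n -> nat)
    (th : I -> 'I_n -> R) x : R :=
  \sum_k c k * cosprod (m k) (th k) x.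

Definition quarter_turn j th i : R := if i == j then th i + pi / 2 else th i.

Lemma cosprod_set_coord m th j a x : cosprod m th (set_coord j a x) =
  cos ((m j)%:R * a + th j) * \prod_(i | i != j) cos ((m i)%:R * x 0 i + th i).
Proof.
rewrite /cosprod (bigD1 j)//= mxE eqxx; congr (_ * _).
by apply: eq_bigr => i /negbTE ij; rewrite mxE ij.
Qed.

Lemma quarter_turn_cosprod m th j x : cosprod m (quarter_turn j th) x =
  - sin ((m j)%:R * x 0 j + th j) * \prod_(i | i != j) cos ((m i)%:R * x 0 i + th i).
Proof.
rewrite /cosprod (bigD1 j)//= /quarter_turn eqxx addrA cosDpihalf; congr (_ * _).
by apply: eq_bigr => i /negbTE ->.
Qed.

Lemma is_derive_of_slice (f : 'rV[R]_n -> R) j x (k : R) :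
  is_derive (x 0 j) 1 (fun b => f (set_coord j b x)) k ->
  is_derive x (delta_mx 0 j) f k.
Proof.
have E : (fun h : R => h^-1 *: (((fun b => f (set_coord j b x)) \o shift (x 0 j)) (h *: (1 : R))
      - f (set_coord j (x 0 j) x))) =
    (fun h => h^-1 *: ((f \o shift x) (h *: delta_mx 0 j) - f x)).
  apply/funext => h /=; rewrite set_coord_id; congr (_ *: (f _ - _)).
  apply/rowP => i; rewrite !mxE/= /GRing.scale/= mulr1.
  by case: eqP => [->|]; rewrite ?mulr1// mulr0 add0r.
move=> [d1 d2]; split; first by rewrite /derivable -E.
by rewrite -d2 /derive -E.
Qed.

Lemma is_derive_cosprod m th j x : is_derive x (delta_mx 0 j) (cosprod m th)
  ((m j)%:R * cosprod m (quarter_turn j th) x).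
Proof.
apply: is_derive_of_slice; rewrite quarter_turn_cosprod.
set P := \prod_(i | _) _.
have -> : (fun b => cosprod m th (set_coord j b x)) =
    fun b => cos ((m j)%:R * b + th j) * P.
  by apply/funext => b; rewrite cosprod_set_coord.
apply: is_derive_eq; rewrite /GRing.scale/=; ring.
Qed.

Lemma is_derive_trigsum (I : finType) (c : I -> R) (m : I -> 'I_n -> nat)
    (th : I -> 'I_n -> R) j x :
  is_derive x (delta_mx 0 j) (trigsum c m th)
    (trigsum (fun k => c k * (m k j)%:R) m (fun k => quarter_turn j (th k)) x).
Proof.
rewrite /trigsum; elim: (index_enum I) => [|k r IH].
  rewrite big_nil (_ : (fun _ => _) = cst 0); first exact: is_derive_cst.
  by apply/funext => y; rewrite big_nil.
rewrite big_cons (_ : (fun _ => _) = (c k *: cosprod (m k) (th k)) +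
    (fun x => \sum_(k <- r) c k * cosprod (m k) (th k) x)).
  apply: (is_derive_eq (is_deriveD (is_deriveZ (c k) (is_derive_cosprod (m k) (th k) j x)) IH)).
  by rewrite /GRing.scale/= mulrA.
by apply/funext => y; rewrite big_cons.
Qed.

Lemma partial_trigsum (I : finType) (c : I -> R) (m : I -> 'I_n -> nat)
    (th : I -> 'I_n -> R) j :
  partial j (trigsum c m th) =
  trigsum (fun k => c k * (m k j)%:R) m (fun k => quarter_turn j (th k)).
Proof.
by apply/funext => x; rewrite /partial; have [_ ->] := is_derive_trigsum c m th j x.
Qed.

Lemma partials_trigsum (I : finType) (c : I -> R) (m : I -> 'I_n -> nat)
    (th : I -> 'I_n -> R) s :
  exists (c' : I -> R) (th' : I -> 'I_n -> R), partials s (trigsum c m th) = trigsum c' m th' :> ('rV[R]_n -> R).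
Proof.
elim: s => [|j s [c' [th' IH]]]; first by exists c, th.
by rewrite /= IH partial_trigsum; do 2 eexists.
Qed.

Lemma continuous_trigsum (I : finType) (c : I -> R) (m : I -> 'I_n -> nat)
    (th : I -> 'I_n -> R) :
  continuous (trigsum c m th : 'rV[R]_n -> R).
Proof.
move=> x; apply: (@cvg_sumr R _ _ (nbhs x)) => k _; apply: cvgM; first exact: cvg_cst.
apply: (@cvg_prodr R _ _ (nbhs x)) => i _; apply: (@cvg_cos R _ (nbhs x)).
apply: cvgD; last exact: cvg_cst.
by apply: cvgMl_tmp; exact: coord_continuous.
Qed.

Lemma cos_periodicn (t : R) k : cos (t + pi *+ (2 * k)) = cos t.
Proof.
elim: k => [|k IH]; first by rewrite muln0 mulr0n addr0.
by rewrite mulnS addnC mulrnDr addrA cosD2pi.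
Qed.

Lemma trigsum_periodic (I : finType) (c : I -> R) (m : I -> 'I_n -> nat)
    (th : I -> 'I_n -> R) :
  Defs.periodic (trigsum c m th : 'rV[R]_n -> R).
Proof.
move=> x i _; apply: eq_bigr => k _; rewrite !cosprod_set_coord; congr (_ * (_ * _)).
rewrite -[LHS](cos_periodicn _ (m k i)); congr cos.
by rewrite mulnC mulrnA -[X in _ + _ + X]mulr_natr mulr2n; ring.
Qed.

Lemma boundary_ext_continuous (g : 'rV[R]_n -> R) x : continuous g ->
  closed_cube x -> boundary_ext g x = g x.
Proof.
move=> cg cx; have := within_cube_proper cx => PF.
rewrite /boundary_ext; apply/cvg_lim => //.
apply: cvg_trans (cg x); apply: cvg_app; exact: cvg_within.
Qed.

Lemma trigsum_smooth (I : finType) (c : I -> R) (m : I -> 'I_n -> nat)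
    (th : I -> 'I_n -> R) :
  smooth_closed_cube (trigsum c m th : 'rV[R]_n -> R).
Proof.
split; first by apply: continuous_subspaceT; exact: continuous_trigsum.
move=> s; have [c' [th' ->]] := partials_trigsum c m th s; split.
  by move=> x i _; have [] := is_derive_trigsum c' m th' i x.
apply: continuous_extends; apply: continuous_subspaceT; exact: continuous_trigsum.
Qed.

Lemma trigsum_periodic_with_partials (I : finType) (c : I -> R) (m : I -> 'I_n -> nat)
    (th : I -> 'I_n -> R) :
  periodic_with_partials (trigsum c m th : 'rV[R]_n -> R).
Proof.
split; first exact: trigsum_periodic.
move=> s x i cx; have [c' [th' ->]] := partials_trigsum c m th s.
have p0 := pi_gt0 R.
rewrite !boundary_ext_continuous; try exact: continuous_trigsum.
- exact: trigsum_periodic.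
- by apply: set_coord_closed => //; apply/andP; split; lra.
- by apply: set_coord_closed => //; apply/andP; split; lra.
Qed.

Lemma trigsum_regular (I : finType) (c : I -> R) (m : I -> 'I_n -> nat)
    (th : I -> 'I_n -> R) :
  regular (trigsum c m th : 'rV[R]_n -> R).
Proof. by apply: smooth_regular; [exact: trigsum_smooth|exact: trigsum_periodic]. Qed.

End trigonometric_sums.

(** * The determinant of cosines *)

Section chebyshev.
Context (R : realType).

(** Chebyshev polynomials of the first kind. *)
Fixpoint cheb k : {poly R} :=
  match k with
  | 0 => 1
  | k'.+1 => match k' with
             | 0 => 'X
             | k''.+1 => 'X * cheb k' *+ 2 - cheb k''
             end
  end.

Lemma chebSS k : cheb k.+2 = 'X * cheb k.+1 *+ 2 - cheb k.
Proof. by []. Qed.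

Lemma horner_cheb (t : R) k : (cheb k).[cos t] = cos (k%:R * t).
Proof.
suff: (cheb k).[cos t] = cos (k%:R * t) /\ (cheb k.+1).[cos t] = cos (k.+1%:R * t).
  by case.
elim: k => [|k [IH1 IH2]]; first by rewrite hornerC hornerX mul0r cos0 mul1r.
split=> //; rewrite chebSS hornerD hornerN hornerMn hornerM hornerX IH1 IH2.
have -> : k.+2%:R * t = k.+1%:R * t + t by rewrite -(natr1 k.+1); ring.
have -> : k%:R * t = k.+1%:R * t - t by rewrite -natr1; ring.
by rewrite cosB cosD mulr2n; ring.
Qed.

Lemma size_cheb k : (size (cheb k) <= k.+1)%N.
Proof.
suff: (size (cheb k) <= k.+1)%N /\ (size (cheb k.+1) <= k.+2)%N by case.
elim: k => [|k [IH1 IH2]]; first by rewrite size_poly1 size_polyX.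
split=> //; rewrite chebSS; apply: leq_trans (size_polyD _ _) _.
rewrite size_polyN geq_max; apply/andP; split; last exact: (leq_trans IH1 (leqW (leqnSn _))).
rewrite -scaler_nat; apply: leq_trans (size_scale_leq _ _) _.
by apply: leq_trans (size_polyMleq _ _) _; rewrite size_polyX.
Qed.

Lemma cheb_lead_gt0 k : 0 < (cheb k)`_k.
Proof.
case: k => [|k]; first by rewrite coefC.
elim: k => [|k IH]; first by rewrite coefX.
rewrite chebSS coefD coefN coefMn coefXM /=.
rewrite [X in _ - X](nth_default 0 (leq_trans (size_cheb k) _))// subr0.
by rewrite pmulrn_lgt0.
Qed.

(** cos (j t) is a polynomial in cos t of degree j, so the matrix is a product of a
    triangular matrix with nonzero diagonal and a Vandermonde matrix, whose nodes
    are distinct because the cosine is injective on [[0, pi]]. *)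
Lemma det_cos_neq0 n (x : 'rV[R]_n) :
  (forall i, 0 <= x 0 i <= pi) -> injective (fun i => x 0 i) ->
  \det (\matrix_(i < n, j < n) cos ((j : nat)%:R * x 0 i)) != 0.
Proof.
move=> x0 xinj; pose y : 'rV[R]_n := \row_i cos (x 0 i).
pose C : 'M[R]_n := \matrix_(j < n, k < n) (cheb j)`_k.
have -> : \matrix_(i < n, j < n) cos ((j : nat)%:R * x 0 i) = (C *m Vandermonde n y)^T.
  apply/matrixP => i j; rewrite !mxE -horner_cheb.
  rewrite (horner_coef_wide _ (leq_trans (size_cheb j) (ltn_ord j))).
  by apply: eq_bigr => k _; rewrite !mxE.
rewrite det_tr det_mulmx mulf_neq0//.
  rewrite det_trig; last first.
    apply/is_trig_mxP => i j ij; rewrite mxE nth_default//.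
    exact: leq_trans (size_cheb i) _.
  by apply/prodf_neq0 => i _; rewrite mxE gt_eqF// cheb_lead_gt0.
rewrite det_Vandermonde; apply/prodf_neq0 => i _; apply/prodf_neq0 => j ij.
rewrite subr_eq0 !mxE; apply: contraTneq ij => /cos_inj E.
by rewrite (xinj i j) ?ltnn//; apply/esym/E; rewrite in_itv/= x0.
Qed.

End chebyshev.

Section slater.
Context (R : realType) (n : nat).
Implicit Types (x : 'rV[R]_n) (i j : 'I_n).

(** The antisymmetrised product of the eigenfunctions 1, cos t, cos (2 t), and so on:
    the ground state of free fermions on even functions. *)
Definition slater x : R := \det (\matrix_(i < n, j < n) cos ((j : nat)%:R * x 0 i)).

Definition energy : R := \sum_(i < n) (i : nat)%:R ^+ 2.

Lemma slaterE : slater = trigsum (fun s : 'S_n => (-1) ^+ s)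
  (fun s i => s i : nat) (fun _ _ => 0).
Proof.
apply/funext => x; apply: eq_bigr => s _; congr (_ * _).
by apply: eq_bigr => i _; rewrite mxE addr0.
Qed.

Lemma slater_regular : regular slater.
Proof. by rewrite slaterE; exact: trigsum_regular. Qed.

Lemma slater_partial_regular j : regular (partial j slater).
Proof. by rewrite slaterE partial_trigsum; exact: trigsum_regular. Qed.

Lemma slater_alternating x i j : i != j -> slater (xcol i j x) = - slater x.
Proof.
move=> ij; rewrite /slater.
have -> : \matrix_(k < n, l < n) cos ((l : nat)%:R * xcol i j x 0 k) =
    xrow i j (\matrix_(k < n, l < n) cos ((l : nat)%:R * x 0 k)).
  by apply/matrixP => k l; rewrite !mxE.
by rewrite xrowE det_mulmx det_perm odd_tperm ij expr1 mulN1r.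
Qed.

(** Each term of the Leibniz expansion is an eigenfunction, with the same eigenvalue
    since its frequencies are a permutation of the numbers below [n]. *)
Lemma slater_laplacian x : \sum_j partial j (partial j slater) x = - energy * slater x.
Proof.
under eq_bigr do rewrite slaterE !partial_trigsum.
rewrite slaterE exchange_big /= mulr_sumr; apply: eq_bigr => s _.
have E j : cosprod (fun i => s i : nat) (quarter_turn j (quarter_turn j (fun=> 0))) x =
    - cosprod (fun i => s i : nat) (fun=> 0) x.
  rewrite /cosprod (bigD1 j)//= [in RHS](bigD1 j)//= -mulNr; congr (_ * _).
    by rewrite /quarter_turn eqxx add0r addr0 (_ : pi / 2 + pi / 2 = pi) ?cosDpi//; lra.
  by apply: eq_bigr => i /negbTE ij; rewrite /quarter_turn ij.
under eq_bigr do rewrite E.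
rewrite /energy [in RHS](reindex_inj (@perm_inj _ s)) /= mulNr mulr_suml -sumrN.
apply: eq_bigr => j _; move: ((-1) ^+ s) (cosprod _ _ _) ((s j : nat)%:R : R) => u v w.
by ring.
Qed.

End slater.

(** * Energy of the determinant of cosines *)

Section slater_energy.
Context (R : realType) (n : nat).
Hypothesis n2 : (2 <= n)%N.
Local Notation slater := (@slater R n).
Local Notation energy := (energy R n).

Lemma energy_gt0 : 0 < energy.
Proof.
rewrite /energy (bigD1 (Ordinal n2))//= expr1n ltr_pwDl//.
by apply: sumr_ge0 => i _; exact: sqr_ge0.
Qed.

Lemma energy_le : energy <= n%:R ^+ 3.
Proof.
apply: (@le_trans _ _ (\sum_(i < n) (n%:R ^+ 2 : R))).
  by apply: ler_sum => i _; rewrite lerXn2r ?nnegrE ?ler0n// ler_nat ltnW.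
by rewrite sumr_const card_ord -[_ *+ n]mulr_natr -exprSr.
Qed.

(** An eigenfunction with nonzero eigenvalue is a sum of derivatives of periodic
    functions. *)
Lemma rint_slater : rint slater = 0.
Proof.
have ts := regular_tame (slater_regular R n).
have tp j := regular_tame (@slater_partial_regular R n j).
have tpp j := regular_partial_tame j (@slater_partial_regular R n j).
have z : rint (fun x => \sum_j partial j (partial j slater) x) = 0.
  rewrite rint_sum// big1// => j _.
  apply: (rint_periodic_partial (j := j) (g := partial j slater)) => //.
  by apply: regular_periodic_partial; exact: slater_partial_regular.
move: z; rewrite (eq_rint (fun x _ => slater_laplacian x)) rintZ//.
move=> /eqP; rewrite mulf_eq0 oppr_eq0 gt_eqF ?energy_gt0//= => /eqP.
exact.
Qed.

(** Green's formula for the eigenfunction [slater]. *)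
Lemma rint_slater_gradient :
  rint (fun x => \sum_j partial j slater x ^+ 2) = energy * rint (fun x => slater x ^+ 2).
Proof.
have rs := slater_regular R n; have ts := regular_tame rs.
have rp j := @slater_partial_regular R n j.
have tp j := regular_partial_tame j rs.
have tpp j := regular_partial_tame j (rp j).
pose div j x := partial j slater x * partial j slater x +
  slater x * partial j (partial j slater) x.
have tdiv j : tame (div j) by apply: tameD; exact: tameM.
have z : rint (fun x => \sum_j div j x) = 0.
  rewrite rint_sum// big1// => j _.
  apply: (rint_periodic_partial (j := j) (g := fun x => slater x * partial j slater x)) => //.
  by apply: has_periodic_partialM; exact: regular_periodic_partial.
rewrite -rintZ; last exact: tameX.
apply/eqP; rewrite -subr_eq0 -rintB; last 2 first.
- by apply: tame_sum => j _; exact: tameX.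
- by apply: tameZ; exact: tameX.
rewrite -[X in _ == X]z; apply/eqP; apply: eq_rint => x _.
rewrite /div big_split /= -mulr_sumr slater_laplacian.
under [in RHS]eq_bigr do rewrite -expr2.
ring.
Qed.

(** The points (i + 1) / (n + 1) are distinct, and lie in the open interval from 0
    to 1, which is smaller than pi. *)
Lemma rint_slater_sqr_gt0 : 0 < rint (fun x => slater x ^+ 2).
Proof.
apply: rint_gt0.
- by apply: tameX; exact: regular_tame (slater_regular R n).
- by move=> x _; exact: sqr_ge0.
pose x : 'rV[R]_n := \row_i ((i : nat).+1%:R / n.+1%:R).
have n0 : 0 < n.+1%:R :> R by [].
have x01 i : 0 < x 0 i < 1.
  by rewrite mxE divr_gt0//= ltr_pdivrMr// mul1r ltr_nat ltnS.
have pi1 : 1 < pi :> R by apply: lt_le_trans (pi_ge2 R); rewrite ltr1n.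
have cx : cube x by move=> i; have /andP[? ?] := x01 i; apply/andP; split; lra.
exists x; first split => //.
  exact: (@cvg_sqr R _ (nbhs x) _ _ _ (regular_cont_cube (slater_regular R n) cx)).
rewrite lt_neqAle sqr_ge0 andbT eq_sym sqrf_eq0; apply: det_cos_neq0.
  by move=> i; have /andP[? ?] := x01 i; apply/andP; split; lra.
move=> i j; rewrite !mxE => /(mulIf (invr_neq0 (lt0r_neq0 n0))) /eqP.
by rewrite eqr_nat eqSS => /eqP/val_inj.
Qed.
End slater_energy.

(** * The sharp constant *)

Section complex_functions.
Context (R : realType) (n : nat).
Hypothesis n2 : (2 <= n)%N.
Implicit Types (psi : 'rV[R]_n -> R[i]) (x : 'rV[R]_n).

Lemma admissible_re psi : admissible psi ->
  regular (re_part psi) /\ alternating_fun (re_part psi).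
Proof.
move=> [[s1 s2] a [[p1 _] [p2 _]] _]; split; first exact: smooth_regular.
by move=> x i j cx ij; rewrite /re_part a//; case: (psi x).
Qed.

Lemma admissible_im psi : admissible psi ->
  regular (im_part psi) /\ alternating_fun (im_part psi).
Proof.
move=> [[s1 s2] a [[p1 _] [p2 _]] _]; split; first exact: smooth_regular.
by move=> x i j cx ij; rewrite /im_part a//; case: (psi x).
Qed.

Lemma sqr_normc (a b : R) : ComplexField.Normc.normc (a +i* b)%C ^+ 2 = a ^+ 2 + b ^+ 2.
Proof. by rewrite /= sqr_sqrtr// addr_ge0// sqr_ge0. Qed.

Lemma hardy_densityE psi x : hardy_density psi x =
  re_part psi x ^+ 2 / sinsum x + im_part psi x ^+ 2 / sinsum x.
Proof.
by rewrite /hardy_density /re_part /im_part; case: (psi x) => a b; rewrite sqr_normc mulrDl.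
Qed.

Lemma sqr_norm_gradientE psi x : sqr_norm_gradient psi x =
  \sum_j partial j (re_part psi) x ^+ 2 + \sum_j partial j (im_part psi) x ^+ 2.
Proof. by rewrite -big_split; apply: eq_bigr => j _; rewrite sqr_normc. Qed.

Lemma gradient_tame (f : 'rV[R]_n -> R) : regular f ->
  tame (fun x => \sum_j partial j f x ^+ 2).
Proof. by move=> rf; apply: tame_sum => j _; apply: tameX; exact: regular_partial_tame. Qed.

Lemma hardy_integralsE psi : admissible psi ->
  cube_integral (hardy_density psi) =
    (rint (fun x => re_part psi x ^+ 2 / sinsum x) +
     rint (fun x => im_part psi x ^+ 2 / sinsum x))%:E /\
  cube_integral (sqr_norm_gradient psi) =
    (rint (fun x => \sum_j partial j (re_part psi) x ^+ 2) +
     rint (fun x => \sum_j partial j (im_part psi) x ^+ 2))%:E.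
Proof.
move=> ap; have [r1 a1] := admissible_re ap; have [r2 a2] := admissible_im ap.
have h1 := hardy_term_tame n2 r1 a1; have h2 := hardy_term_tame n2 r2 a2.
have g1 := gradient_tame r1; have g2 := gradient_tame r2.
split.
  rewrite (eq_cube_integral (fun x _ => hardy_densityE psi x)).
  by rewrite cube_integral_rint ?rintD//; exact: tameD.
rewrite (eq_cube_integral (fun x _ => sqr_norm_gradientE psi x)).
by rewrite cube_integral_rint ?rintD//; exact: tameD.
Qed.

Lemma hardy_inequality_lower : (3 <= n)%N ->
  hardy_inequality n (n%:R ^+ 4 / 96 : R).
Proof.
move=> n3 psi ap; have [-> ->] := hardy_integralsE ap.
have [r1 a1] := admissible_re ap; have [r2 a2] := admissible_im ap.
by rewrite -EFinM lee_fin mulrDr lerD// real_hardy.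
Qed.

Lemma hardy_inequality0 : hardy_inequality n (0 : R).
Proof.
move=> psi ap; have [-> ->] := hardy_integralsE ap.
rewrite mul0e lee_fin addr_ge0// rint_ge0// => x _; apply: sumr_ge0 => j _;
exact: sqr_ge0.
Qed.

Definition slater_complex x : R[i] := (slater x +i* 0)%C.

Lemma slater_admissible : admissible slater_complex.
Proof.
have E0 : im_part slater_complex =
    trigsum (fun _ : 'I_0 => 0) (fun _ _ => 0%N) (fun _ _ => 0) :> ('rV[R]_n -> R).
  by apply/funext => x; rewrite /trigsum big_ord0.
split.
- split; last by rewrite E0; exact: trigsum_smooth.
  by rewrite -[re_part _]/(slater (n:=n)) slaterE; exact: trigsum_smooth.
- move=> x i j _ ij; rewrite /slater_complex slater_alternating//.
  by apply/eqP; rewrite eq_complex /= oppr0 !eqxx.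
- split; last by rewrite E0; exact: trigsum_periodic_with_partials.
  by rewrite -[re_part _]/(slater (n:=n)) slaterE; exact: trigsum_periodic_with_partials.
- split.
    rewrite -[re_part _]/(slater (n:=n)) cube_integral_rint ?rint_slater//.
    exact: regular_tame (slater_regular R n).
  rewrite -[im_part _]/(fun=> 0) cube_integral_rint ?rint0//.
  exact: tame_cst.
Qed.

(** The denominator is at most [n], so the test function bounds [C] by [n] times its
    eigenvalue. *)
Lemma hardy_inequality_upper (C : R) : hardy_inequality n C -> C <= n%:R ^+ 4.
Proof.
move=> hC; have [C0|C0] := leP C 0; first by rewrite (le_trans C0)// exprn_ge0.
have ap := slater_admissible; have := hC _ ap; have [-> ->] := hardy_integralsE ap.
have [r1 a1] := admissible_re ap.
rewrite -EFinM lee_fin -[re_part _]/(slater (n:=n)) -[im_part _]/(fun=> 0).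
have -> : rint (fun x : 'rV[R]_n => 0 ^+ 2 / sinsum x) = 0.
  by rewrite -[RHS](rint0 R n); apply: eq_rint => x _; rewrite expr0n/= mul0r.
have -> : rint (fun x : 'rV[R]_n => \sum_j partial j (fun=> 0) x ^+ 2) = 0.
  rewrite -[RHS](rint0 R n); apply: eq_rint => x _; rewrite big1// => j _.
  by rewrite /partial (_ : (fun=> 0) = cst 0)// derive_cst expr0n.
rewrite !addr0 rint_slater_gradient => hE.
have P := rint_slater_sqr_gt0 R n; have tsq := tameX 2 (regular_tame r1).
have n0 : 0 < n%:R :> R by rewrite ltr0n ltnW.
have low : n%:R^-1 * rint (fun x => slater (n:=n) x ^+ 2) <=
    rint (fun x => slater (n:=n) x ^+ 2 / sinsum x) :> R.
  rewrite -rintZ//; apply: le_rint; [exact: tameZ|exact: (hardy_term_tame n2 r1 a1)|].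
  move=> x cx; have [->|s0] := eqVneq (slater x) 0.
    by rewrite expr0n/= mul0r mulr0.
  rewrite mulrC ler_wpM2l ?sqr_ge0//.
  have sn : sinsum x <= n%:R.
    apply: (@le_trans _ _ (\sum_(i < n) 1)); last by rewrite sumr_const card_ord.
    by apply: ler_sum => i _; have := cos2Dsin2 (x 0 i / 2); have := sqr_ge0 (cos (x 0 i / 2)); lra.
  have s1 : 0 < sinsum x.
    rewrite lt_neqAle eq_sym sumr_ge0 ?andbT; last by move=> i _; exact: sqr_ge0.
    apply: contraNneq s0 => sx.
    have [K K0 fK] := antisymmetric_sqr_le r1 a1.
    have := antisymmetric_sqr_le_cosum n2 K0 fK (sub_cube_closed cx).
    rewrite cosumE sx !mulr0 => h; rewrite -sqrf_eq0 eq_le sqr_ge0 andbT; exact: h.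
  by rewrite lef_pV2 ?posrE.
have : C * n%:R^-1 * rint (fun x => slater (n:=n) x ^+ 2) <=
    energy R n * rint (fun x => slater (n:=n) x ^+ 2).
  by apply: le_trans hE; rewrite -mulrA ler_wpM2l// ltW.
rewrite ler_pM2r// ler_pdivrMr// => /le_trans; apply.
by rewrite exprSr ler_wpM2r ?energy_le// ltW.
Qed.

(** The supremum is attained because both integrals are finite, which makes the
    inequality a closed condition on the constant. *)
Lemma hardy_inequality_sup :
  has_sup [set C : R | hardy_inequality n C] /\
  hardy_inequality n (sup [set C : R | hardy_inequality n C]).
Proof.
have hs : has_sup [set C : R | hardy_inequality n C].
  split; first by exists 0; exact: hardy_inequality0.
  by exists (n%:R ^+ 4) => C; exact: hardy_inequality_upper.
split=> // psi ap; have [E1 E2] := hardy_integralsE ap.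
have I0 : 0 <= rint (fun x => re_part psi x ^+ 2 / sinsum x) +
    rint (fun x => im_part psi x ^+ 2 / sinsum x).
  by apply: addr_ge0; apply: rint_ge0 => x _; rewrite divr_ge0 ?sqr_ge0//;
    apply: sumr_ge0 => i _; exact: sqr_ge0.
have h C : hardy_inequality n C ->
    (C%:E * cube_integral (hardy_density psi) <= cube_integral (sqr_norm_gradient psi))%E.
  by move=> /(_ psi ap).
rewrite E1 E2 -EFinM lee_fin; move: h I0; rewrite E1 E2.
move: (_ + _) (_ + _) => I G h; rewrite le_eqVlt => /predU1P[I0|I0].
  by have := h 0 hardy_inequality0; rewrite -EFinM lee_fin -I0 !mulr0.
rewrite -ler_pdivlMr//; apply: ge_sup; first by case: hs.
by move=> C /h; rewrite -EFinM lee_fin ler_pdivlMr.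
Qed.

End complex_functions.

Theorem theorem1p7 (R : realType) :
  exists C : nat -> R,
    (forall d : nat, (2 <= d)%N -> sharp_hardy_constant d (C d)) /\
    exists (c1 c2 : R) (N : nat),
      [/\ 0 < c1, 0 < c2, (0 < N)%N &
        forall d : nat, (2 <= d)%N -> (N <= d)%N ->
          c1 * d%:R ^+ 4 <= C d <= c2 * d%:R ^+ 4].
Proof.
exists (fun d => sup [set C : R | hardy_inequality d C]); split.
  move=> d d2; have [hs h] := hardy_inequality_sup R d2; split=> // C hC.
  have h' := @ub_le_sup R _ (proj2 hs); exact: h'.
exists 96^-1, 1, 3%N; split=> // d d2 d3; have [hs h] := hardy_inequality_sup R d2.
apply/andP; split; last by rewrite mul1r; exact: hardy_inequality_upper.
have := @ub_le_sup R _ (proj2 hs); apply.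
by rewrite /= mulrC; exact: hardy_inequality_lower.
Qed.
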